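(* Let $n\ge2$ and $\delta\in(0,n]$. (a) If $\Omega$ is a bounded domain in $\mathbb{R}^n$ and $p\in(\delta/n,\infty)$, then there exists a constant $c$ depending only on $n$, $\delta$ and $p$ such that $$\int_\Omega|u(x)|^p\,d\mathcal{H}^\delta_\infty\le c\,\operatorname{diam}(\Omega)^p\int_\Omega|\nabla u(x)|^p\,d\mathcal{H}^\delta_\infty$$ for all $u\in C^1_0(\Omega)$. (b) If $\Omega$ is a domain in $\mathbb{R}^n$, $\kappa\in[0,1)$ and $p\in(\delta/n,\delta)$, then there exists a constant $c$ depending only on $n$, $\delta$, $\kappa$ and $p$ such that $$\Big(\int_\Omega|u(x)|^{\frac{p(\delta-\kappa p)}{\delta-p}}\,d\mathcal{H}^{\delta-\kappa p}_\infty\Big)^{\frac{\delta-p}{p(\delta-\kappa p)}}\le c\Big(\int_\Omega|\nabla u(x)|^p\,d\mathcal{H}^\delta_\infty\Big)^{\frac1p}$$ for all $u\in C^1_0(\Omega)$.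
   Context: A domain is an open, connected set in $\mathbb{R}^n$, $n\ge 2$. For $\delta\in(0,n]$ and $E\subset\mathbb{R}^n$, the $\delta$-dimensional Hausdorff content is $$\mathcal{H}^\delta_\infty(E):=\inf\Big\{\sum_{i} r_i^\delta : E\subset\bigcup_{i}B(x_i,r_i)\Big\},$$ the infimum being taken over all finite or countable coverings of $E$ by open balls $B(x_i,r_i)$. For $f:\Omega\to[0,\infty]$ the Choquet integral with respect to $\mathcal{H}^\delta_\infty$ is $$\int_\Omega f(x)\,d\mathcal{H}^\delta_\infty:=\int_0^\infty\mathcal{H}^\delta_\infty(\{x\in\Omega: f(x)>t\})\,dt .$$ $C^1_0(\Omega)$ denotes the continuously differentiable real-valued functions on $\Omega$ with compact support in $\Omega$. *)

(* Defs.v *)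
From HB Require Import structures.
From mathcomp Require Import all_boot all_order all_algebra.
From mathcomp Require Import all_classical all_reals all_analysis.
Import Order.TTheory GRing.Theory Num.Theory.
Import numFieldNormedType.Exports.

Set Implicit Arguments.
Unset Strict Implicit.
Unset Printing Implicit Defensive.

Local Open Scope classical_set_scope.
Local Open Scope ring_scope.

(* The norm carried by ['rV[R]_n] in the library is the sup norm. It induces
   the usual topology and notions of boundedness and differentiability, but
   balls, diameters and lengths of gradients are Euclidean below. *)
Definition enorm (R : realType) (n : nat) (x : 'rV[R]_n) : R :=
  Num.sqrt (\sum_(i < n) x ord0 i ^+ 2).

Definition eball (R : realType) (n : nat) (x : 'rV[R]_n) (r : R) :
    set 'rV[R]_n :=
  [set y | enorm (x - y) < r].

(* This is the real supremum, so it is meaningful for bounded [A] only;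
   the diameter of the empty set is 0. *)
Definition ediam (R : realType) (n : nat) (A : set 'rV[R]_n) : R :=
  sup [set enorm (x - y) | x in A & y in A].

Definition domain (R : realType) (n : nat) (Omega : set 'rV[R]_n) : Prop :=
  open Omega /\ connected Omega.

(* Finite and countable families of balls are the families indexed by an
   arbitrary set [I] of natural numbers. *)
Definition hausdorff_content (R : realType) (n : nat) (delta : R)
    (E : set 'rV[R]_n) : \bar R :=
  ereal_inf [set s : \bar R |
    exists (I : set nat) (x : nat -> 'rV[R]_n) (r : nat -> R),
      [/\ forall i, I i -> 0 < r i,
          E `<=` \bigcup_(i in I) eball (x i) (r i) &
          s = (\esum_(i in I) (r i `^ delta)%:E)%E]].

Definition choquet_integral (R : realType) (n : nat) (delta : R)
    (Omega : set 'rV[R]_n) (f : 'rV[R]_n -> \bar R) : \bar R :=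
  (\int[lebesgue_measure]_(t in `[0%R, +oo[)
     hausdorff_content delta [set x | Omega x /\ (t%:E < f x)%E])%E.

Definition gradient (R : realType) (n : nat) (u : 'rV[R]_n -> R)
    (x : 'rV[R]_n) : 'rV[R]_n :=
  \row_(i < n) 'D_(delta_mx ord0 i) u x.

(* An element of C^1_0(Omega) is represented by a total function whose values
   outside [Omega] are irrelevant: the support is the closure of the set of
   points of [Omega] where [u] does not vanish. *)
Definition C1_0 (R : realType) (n : nat) (Omega : set 'rV[R]_n)
    (u : 'rV[R]_n -> R) : Prop :=
  let supp := closure [set x | Omega x /\ u x != 0] in
  [/\ forall x, Omega x -> differentiable u x,
      forall x, Omega x -> {for x, continuous (gradient u)},
      compact supp &
      supp `<=` Omega].

(* Main.v *)
Require Import Defs.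
From mathcomp Require Import all_boot all_order all_algebra.
From mathcomp Require Import all_classical all_reals all_analysis.
From mathcomp Require Import measurable_realfun zify ring lra finmap.
Import Order.TTheory GRing.Theory Num.Theory.
Import numFieldNormedType.Exports.

(** The proof uses dyadic cubes and means of continuous functions over them; no
    measure on the space appears.

    Extend [u] by zero, let [g] be the length of its gradient, and place the
    support of [u] in one of the children of a cube, the root of a dyadic tree.
    Averages of [u] over two siblings differ by at most a constant times the side
    of the parent times the mean of [g] over the parent ([avg_siblings]).
    Telescoping from a sibling on which [u] vanishes down to a point [x] gives
    [pointwise_bound]: |u(x)| is at most a constant times the sum, over the cubes
    Q containing [x], of side(Q) times the mean of [g] over Q. The means of [g] are
    upper Darboux means ([umean]).

    What remains is a maximal inequality. Cover the level sets
    {g >= level i}, level i = Lam / 2^i, by finite lists of cubes. The descent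
    [umean_le_cap] along nested cubes plays the role of the countable
    subadditivity of volume: if the mean of [g] over D exceeds level k, and D lies
    in no covering cube, then the volume of D is at most the sum of
    2^(k+2-i) vol(B) over the covering cubes B of level i <= k+1 contained in D.
    Raising this to the power delta/n <= 1 turns volumes into sides to the power
    delta ([stopping_size]). Each B lies in at most one of the maximal cubes D
    ([stopping]), so their total size is controlled by the sizes of the covers
    ([stopping_sum]). Multiplying by (level k)^p and summing over k is a
    convolution with a geometric sequence of ratio 2^(delta/n - p), and this is
    where p > delta/n is used ([sum_level_cost]). Since every cube of mean
    exceeding level k lies in a maximal one, the layer-cake formula bounds
    the Choquet integral, with respect to the content of dimension
    delta - kappa p, of the p-th power of the supremum over the cubes Q
    containing x of side(Q)^kappa times the mean of [g] over Q ([choquet_le]).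
    Compactness and the definition of the content give covers whose sizes are
    controlled by the Choquet integral of g^p ([level_covers]).

    For (a), the sides of the cubes containing [x] sum to twice that of the root,
    which is comparable to the diameter, so |u(x)| is at most a constant times the
    diameter times a maximal function of [g] ([poincare_bound]). For (b), the means over large cubes
    are instead bounded by the integral of g^p ([umean_size]); splitting the sum
    over the cubes at the best scale, as Hedberg does, bounds a power of |u(x)| by
    the p-th power of the fractional maximal function ([sobolev_bound]). *)

Set Implicit Arguments.
Unset Strict Implicit.
Unset Printing Implicit Defensive.

Local Open Scope classical_set_scope.
Local Open Scope ring_scope.

(** * Dyadic cubes and averages over their descendants *)

(** The pair (j, z) stands for the closed cube of side L / 2^j with lower corner
    a + (L / 2^j) z, see [ccube]; the origin [a] and the size [L] of the grid are
    fixed later. The larger the first component, the smaller the cube. *)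
Definition cube (n : nat) : Type := (nat * {ffun 'I_n -> nat})%type.

(** The cube of generation [j] containing [Q]; this makes sense for [j <= Q.1]. *)
Definition anc (n j : nat) (Q : cube n) : cube n :=
  (j, [ffun i => Q.2 i %/ 2 ^ (Q.1 - j)]%N).

Definition subcube (n : nat) (Q B : cube n) : bool :=
  (B.1 <= Q.1)%N && (anc B.1 Q == B).

Definition child (n : nat) (Q : cube n) (e : {ffun 'I_n -> bool}) : cube n :=
  (Q.1.+1, [ffun i => e i + (Q.2 i).*2]%N).

Definition topcube (n : nat) : cube n := (0%N, [ffun=> 0%N]).

Section Cubes.
Variable n : nat.
Implicit Types (Q B D : cube n) (e : {ffun 'I_n -> bool}).

Lemma anc_anc j j' Q : (j <= j' <= Q.1)%N -> anc j (anc j' Q) = anc j Q.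
Proof.
move=> /andP[jj' j'Q]; congr pair; apply/ffunP=> i; rewrite !ffunE /=.
by rewrite -divnMA -expnD; congr (_ %/ 2 ^ _)%N; lia.
Qed.

Lemma anc_self Q : anc Q.1 Q = Q.
Proof.
case: Q => j z; congr pair; apply/ffunP => i.
by rewrite !ffunE /= subnn expn0 divn1.
Qed.

Lemma subcube_anc j Q : (j <= Q.1)%N -> subcube Q (anc j Q).
Proof. by move=> jQ; rewrite /subcube jQ /=. Qed.

Lemma subcube_refl Q : subcube Q Q.
Proof. by rewrite /subcube leqnn anc_self /=. Qed.

Lemma subcube_level Q B : subcube Q B -> (B.1 <= Q.1)%N.
Proof. by case/andP. Qed.

Lemma subcubeE Q B : subcube Q B -> B = anc B.1 Q.
Proof. by case/andP=> _ /eqP. Qed.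

Lemma subcube_trans D Q B : subcube Q D -> subcube D B -> subcube Q B.
Proof.
move=> /andP[DQ /eqP QD] /andP[BD /eqP DB].
rewrite /subcube (leq_trans BD DQ) /=; apply/eqP.
by rewrite -(@anc_anc _ D.1) ?BD // QD.
Qed.

Lemma subcube_nested Q B D :
  subcube Q B -> subcube Q D -> (B.1 <= D.1)%N -> subcube D B.
Proof.
move=> /andP[BQ /eqP QB] /andP[DQ /eqP QD] BD.
by rewrite /subcube BD -{1}QD anc_anc ?BD ?DQ //= QB.
Qed.

Lemma subcube_eq Q B : subcube Q B -> Q.1 = B.1 -> Q = B.
Proof. by move=> QB QB1; rewrite (subcubeE QB) -QB1 anc_self. Qed.

Lemma subcube_child Q e : subcube (child Q e) Q.
Proof.
rewrite /subcube leqnSn /=; apply/eqP; case: Q => j z; congr pair.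
apply/ffunP=> i; rewrite !ffunE /= subSnn expn1 divn2.
by case: (e i); rewrite /= ?add0n ?uphalf_double ?doubleK.
Qed.

Lemma child_inj Q : injective (child Q).
Proof.
move=> e e' [ee']; apply/ffunP => i.
have := congr1 (fun z : {ffun 'I_n -> nat} => odd (z i)) ee'.
by rewrite !ffunE !oddD !odd_double !addbF !oddb.
Qed.

Lemma subcube_child_uniq B Q e e' :
  subcube B (child Q e) -> subcube B (child Q e') -> e = e'.
Proof.
move=> Be Be'; apply: (@child_inj Q).
by apply: subcube_eq => //; apply: (subcube_nested Be').
Qed.

Lemma subcube_child_inv Q e B :
  subcube (child Q e) B -> B = child Q e \/ subcube Q B.
Proof.
move=> eB; have := subcube_level eB; rewrite leq_eqVlt => /orP[/eqP eB1|].
  by left; rewrite (subcube_eq eB).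
by move=> BQ; right; apply: (subcube_nested eB (subcube_child Q e)).
Qed.

End Cubes.

Definition avg (R : realFieldType) (n : nat) (f : cube n -> R) (Q : cube n) : R :=
  2^-1 ^+ n * \sum_(e : {ffun 'I_n -> bool}) f (child Q e).

Section Averages.
Variables (R : realFieldType) (n : nat).
Implicit Types (Q : cube n) (f g : cube n -> R) (e : {ffun 'I_n -> bool}).

Lemma avg_cst Q (c : R) : avg (fun=> c) Q = c.
Proof.
rewrite /avg sumr_const card_ffun card_bool card_ord -(mulr_natr c) natrX.
by rewrite mulrCA -exprMn mulVf ?expr1n ?mulr1// pnatr_eq0.
Qed.

Lemma ler_avg f g Q : (forall e, f (child Q e) <= g (child Q e)) ->
  avg f Q <= avg g Q.
Proof.
by move=> fg; rewrite /avg ler_wpM2l// ?exprn_ge0 ?invr_ge0//; apply: ler_sum.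
Qed.

Lemma avgD f g Q : avg (fun P => f P + g P) Q = avg f Q + avg g Q.
Proof. by rewrite /avg big_split mulrDr. Qed.

Lemma avgB f g Q : avg (fun P => f P - g P) Q = avg f Q - avg g Q.
Proof. by rewrite /avg sumrB mulrBr. Qed.

Lemma ler_norm_avg f Q : `|avg f Q| <= avg (fun P => `|f P|) Q.
Proof.
rewrite /avg normrM ger0_norm ?exprn_ge0 ?invr_ge0//.
by rewrite ler_wpM2l ?exprn_ge0 ?invr_ge0// ler_norm_sum.
Qed.

Lemma ler_iter_avg N f g Q : (forall P, subcube P Q -> f P <= g P) ->
  iter N (@avg R n) f Q <= iter N (@avg R n) g Q.
Proof.
elim: N Q => [|N IH] Q fg /=; first exact/fg/subcube_refl.
apply: ler_avg => e; apply: IH => P PQ; apply: fg.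
exact: subcube_trans PQ (subcube_child Q e).
Qed.

Lemma iter_avg_cst N Q (c : R) : iter N (@avg R n) (fun=> c) Q = c.
Proof.
elim: N Q => [//|N IH] Q; rewrite iterS.
transitivity (avg (fun=> c) Q); last exact: avg_cst.
by rewrite /avg; under eq_bigr do rewrite IH.
Qed.

(** Recursion over children does not see lattice translations; this closed form,
    a sum over a box of lattice points, does. *)
Lemma iter_avgE N f Q : iter N (@avg R n) f Q = 2^-1 ^+ (n * N) *
  \sum_(w : {ffun 'I_n -> 'I_(2 ^ N)})
     f ((Q.1 + N)%N, [ffun i => w i + Q.2 i * 2 ^ N]%N).
Proof.
elim: N f Q => [|N IH] f Q.
  have wP (w : {ffun 'I_n -> 'I_(2 ^ 0)}) : f ((Q.1 + 0)%N,
      [ffun i => w i + Q.2 i * 2 ^ 0]%N) = f Q.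
    case: Q => j z; congr f; congr pair; rewrite ?addn0//.
    apply/ffunP => i; rewrite ffunE /=.
    by case: (w i) => -[?|//]; rewrite /= expn0 muln1.
  under eq_bigr do rewrite wP.
  by rewrite muln0 expr0 mul1r sumr_const card_ffun !card_ord expn0 exp1n.
rewrite iterSr IH /avg -big_distrr/= mulrA -exprD -mulnSr; congr (_ * _).
rewrite pair_big /=.
have oP (e : bool) (w : 'I_(2 ^ N)) : (e + w.*2 < 2 ^ N.+1)%N.
  by case: w => w /=; rewrite expnS; lia.
have hP (w : 'I_(2 ^ N.+1)) : (w./2 < 2 ^ N)%N.
  by case: w => w /=; rewrite expnS; lia.
pose F (p : {ffun 'I_n -> 'I_(2 ^ N)} * {ffun 'I_n -> bool}) :
  {ffun 'I_n -> 'I_(2 ^ N.+1)} := [ffun i => Ordinal (oP (p.2 i) (p.1 i))].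
pose H (w : {ffun 'I_n -> 'I_(2 ^ N.+1)}) :
  {ffun 'I_n -> 'I_(2 ^ N)} * {ffun 'I_n -> bool} :=
  ([ffun i => Ordinal (hP (w i))], [ffun i => odd (w i)]).
have FH : cancel F H.
  move=> [w e]; congr pair; apply/ffunP => i; rewrite !ffunE /=.
    by apply: val_inj => /=; case: (e i); rewrite /= ?add0n ?uphalf_double ?doubleK.
  by rewrite oddD odd_double addbF oddb.
have HF : cancel H F.
  move=> w; apply/ffunP => i; rewrite !ffunE /=; apply: val_inj => /=.
  exact: odd_double_half.
rewrite [RHS](reindex F); last by exists H => ? _.
apply: eq_bigr => -[w e] _ /=; congr f; rewrite /child /=; congr pair; first lia.
by apply/ffunP => i; rewrite !ffunE /= expnS; lia.
Qed.

End Averages.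

Section Shift.
Variables (R : realFieldType) (n : nat) (i : 'I_n).
Implicit Types (z : {ffun 'I_n -> nat}) (f : {ffun 'I_n -> nat} -> R).

Definition shiftc (t : nat) z : {ffun 'I_n -> nat} :=
  [ffun k => z k + (k == i) * t]%N.

(** A block of side [K] shifted by [t < K] lies in the block and its neighbour.
    The part that stays and the part that leaves together form a rotation modulo
    [K] of the coordinates, so no lattice point of either block is hit twice. *)
Lemma window_le (K : nat) z t f : (t < K)%N -> (forall y, 0 <= f y) ->
  \sum_(w : {ffun 'I_n -> 'I_K}) f (shiftc t [ffun k => w k + z k * K]%N)
  <= \sum_(w : {ffun 'I_n -> 'I_K}) f [ffun k => w k + z k * K]%N
   + \sum_(w : {ffun 'I_n -> 'I_K}) f [ffun k => w k + shiftc 1 z k * K]%N.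
Proof.
move=> tK f0.
have K0 : (0 < K)%N by exact: leq_trans tK.
pose rot (s : nat) (w : {ffun 'I_n -> 'I_K}) : {ffun 'I_n -> 'I_K} :=
  [ffun k => if k == i then Ordinal (ltn_pmod (w k + s) K0) else w k].
have rotK s s' : (s + s' = K)%N -> cancel (rot s) (rot s').
  move=> ss' w; apply/ffunP => k; rewrite !ffunE; case: eqP => //= _.
  apply: val_inj => /=; rewrite modnDml -addnA ss' modnDr modn_small//.
rewrite -big_split /= [leRHS](reindex (rot t)); last first.
  by exists (rot (K - t)%N) => w _; apply: rotK; lia.
apply: ler_sum => w _.
have [wt|wt] := ltnP (w i + t)%N K.
- rewrite [X in f X](_ : _ = [ffun k => rot t w k + z k * K]%N) ?lerDl//.
  apply/ffunP => k; rewrite !ffunE; case: eqP => [->|_] /=; last lia.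
  by rewrite modn_small//; lia.
- rewrite [X in f X](_ : _ = [ffun k => rot t w k + shiftc 1 z k * K]%N) ?lerDr//.
  apply/ffunP => k; rewrite !ffunE; case: eqP => [->|_] /=; last by lia.
  rewrite mul1n.
  have -> : ((w i + t) %% K = w i + t - K)%N.
    rewrite -(modn_small (_ : w i + t - K < K)%N); last by have := ltn_ord (w i); lia.
    by rewrite -{1}(subnK wt) modnDr.
  by lia.
Qed.

End Shift.

(** * Geometry of the cubes *)

Definition side (R : realType) (L : R) (j : nat) : R := L / 2 ^+ j.

Definition corner (R : realType) (n : nat) (a : 'rV[R]_n) (L : R) (Q : cube n) :
  'rV[R]_n := \row_i (a ord0 i + side L Q.1 * (Q.2 i)%:R).

Definition ccube (R : realType) (n : nat) (a : 'rV[R]_n) (L : R) (Q : cube n) :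
  set 'rV[R]_n := [set x | forall i,
    corner a L Q ord0 i <= x ord0 i <= corner a L Q ord0 i + side L Q.1].

Section Geometry.
Variables (R : realType) (n : nat) (a : 'rV[R]_n) (L : R).
Hypothesis L0 : 0 < L.
Implicit Types (Q B D : cube n) (x : 'rV[R]_n).
Local Notation sd := (side L).
Local Notation crn := (corner a L).
Local Notation cc := (ccube a L).

Lemma side_gt0 j : 0 < sd j.
Proof. by rewrite divr_gt0 ?exprn_gt0. Qed.

Lemma side_ge0 j : 0 <= sd j.
Proof. exact/ltW/side_gt0. Qed.

Lemma sideS j : sd j = 2 * sd j.+1.
Proof. by rewrite /side exprS; field; rewrite expf_neq0. Qed.

Lemma sideD j d : sd j = sd (j + d) * (2 ^ d)%:R.
Proof.
by rewrite /side natrX exprD invfM -!mulrA mulVf ?mulr1// expf_neq0.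
Qed.

Lemma side_le j j' : (j <= j')%N -> sd j' <= sd j.
Proof.
move=> jj'; rewrite /side ler_pM2l // lef_pV2 ?posrE ?exprn_gt0//.
by rewrite ler_weXn2l// ler1n.
Qed.

Lemma side_small (e : R) : 0 < e -> exists j0, forall j, (j0 <= j)%N -> sd j < e.
Proof.
move=> e0; exists (Num.truncn (L / e)).+1 => j jj0.
rewrite /side ltr_pdivrMr ?exprn_gt0// mulrC -ltr_pdivrMr//.
apply: lt_le_trans (truncnS_gt _) _.
rewrite -natrX ler_nat; apply: leq_trans jj0 _; exact/ltnW/ltn_expl.
Qed.

Lemma ccube_corner Q : cc Q (crn Q).
Proof. by move=> i; rewrite lexx lerDl side_ge0. Qed.

Lemma ccube_sub Q B : subcube Q B -> cc Q `<=` cc B.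
Proof.
move=> QB x Qx i; have /andP[lo hi] := Qx i.
have BQ := subcube_level QB.
move: lo hi; rewrite /corner !mxE; rewrite (subcubeE QB) /= ffunE.
pose d := (Q.1 - B.1)%N; rewrite -/d (sideD B.1 d) (_ : B.1 + d = Q.1)%N; last by rewrite /d; lia.
move: (Q.2 i) => z lo hi.
have s0 := side_gt0 Q.1.
have zlo : ((z %/ 2 ^ d) * 2 ^ d)%N%:R <= z%:R :> R by rewrite ler_nat leq_divM.
have zhi : z%:R + 1 <= ((z %/ 2 ^ d).+1 * 2 ^ d)%N%:R :> R.
  by rewrite natr1 ler_nat ltn_ceil// expn_gt0.
have := ler_wpM2l (ltW s0) zlo; have := ler_wpM2l (ltW s0) zhi; move: lo hi.
rewrite !natrM -natr1; move: (sd _) (z %/ _)%N%:R (2 ^ d)%:R => v q k *.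
by apply/andP; split; lra.
Qed.

Definition vol Q : R := sd Q.1 ^+ n.

Lemma vol_gt0 Q : 0 < vol Q. Proof. by rewrite exprn_gt0 ?side_gt0. Qed.

Lemma vol_child Q e : vol Q = 2 ^+ n * vol (child Q e).
Proof. by rewrite /vol /= sideS exprMn. Qed.

(** The volume of the intersection of [Q] and [B], since two dyadic cubes are
    nested or have disjoint interiors. *)
Definition cap Q B : R :=
  if subcube Q B then vol Q else if subcube B Q then vol B else 0.

Lemma cap_ge0 Q B : 0 <= cap Q B.
Proof. by rewrite /cap; case: ifP => _; [|case: ifP => _]; rewrite ?(ltW (vol_gt0 _)). Qed.

(** The intersection of [B] with a cube is split among the children: if [B] is
    strictly smaller than [Q], at most one child meets it. *)
Lemma cap_children Q B : \sum_e cap (child Q e) B <= cap Q B.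
Proof.
have [QB|QB] := boolP (subcube Q B).
  rewrite (eq_bigr (fun=> vol (child Q [ffun=> false]))) => [|e _]; last first.
    by rewrite /cap (subcube_trans (subcube_child Q e) QB).
  rewrite /cap QB sumr_const card_ffun card_bool card_ord (vol_child Q [ffun=> false]).
  by rewrite -(mulr_natr (vol _)) natrX mulrC.
have capE e : cap (child Q e) B = if subcube B (child Q e) then vol B else 0.
  rewrite /cap; case: ifPn => // eB.
  have [->|QB'] := subcube_child_inv eB; first by rewrite subcube_refl.
  by rewrite QB' in QB.
rewrite (eq_bigr _ (fun e _ => capE e)) /cap (negPf QB).
case: ifPn => BQ; last first.
  rewrite big1// => e _; case: ifPn => // Be.
  by move: BQ; rewrite (subcube_trans Be (subcube_child Q e)).
have [/existsP[e0 Be0]|/existsPn ne] := boolP [exists e, subcube B (child Q e)];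
  last by rewrite big1 => [|e _]; rewrite ?(negPf (ne e))// ltW ?vol_gt0.
rewrite (bigD1 e0)//= Be0 big1 ?addr0// => e ee0.
case: ifPn => // Be; by rewrite (subcube_child_uniq Be Be0) eqxx in ee0.
Qed.

End Geometry.

(** * Upper means *)

(** Together with [darboux] this defines the upper Darboux integral, divided by
    the volume. The properties of means used below are [umean_le_avg] and
    [umean_le_csup]. *)
Definition csup (R : realType) (n : nat) (a : 'rV[R]_n) (L : R)
  (g : 'rV[R]_n -> R) (Q : cube n) : R := sup [set g x | x in ccube a L Q].

Definition darboux (R : realType) (n : nat) (a : 'rV[R]_n) (L : R)
  (g : 'rV[R]_n -> R) (N : nat) : cube n -> R :=
  iter N (@avg R n) (csup a L g).

Definition umean (R : realType) (n : nat) (a : 'rV[R]_n) (L : R)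
  (g : 'rV[R]_n -> R) (Q : cube n) : R :=
  inf (range (fun N => darboux a L g N Q)).

Section UpperMean.
Variables (R : realType) (n : nat) (a : 'rV[R]_n) (L : R).
Hypothesis L0 : 0 < L.
Variables (g : 'rV[R]_n -> R) (Lam : R).
Hypothesis g_ge0 : forall x, 0 <= g x.
Hypothesis g_lt : forall x, g x < Lam.
Hypothesis g_cont : continuous g.
Implicit Types (Q B D : cube n) (x : 'rV[R]_n).
Local Notation sd := (side L).
Local Notation crn := (corner a L).
Local Notation cc := (ccube a L).
Local Notation G := (csup a L g).
Local Notation A := (darboux a L g).
Local Notation M := (umean a L g).

Lemma csup_ub Q x : cc Q x -> g x <= G Q.
Proof.
move=> Qx; apply: ub_le_sup; last by exists x.
by exists Lam => _ [y _ <-]; exact/ltW.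
Qed.

Lemma csup_le Q c : (forall x, cc Q x -> g x <= c) -> G Q <= c.
Proof.
move=> gc; apply: ge_sup; first by exists (g (crn Q)); exists (crn Q) => //; exact: ccube_corner.
by move=> _ [y Qy <-]; exact: gc.
Qed.

Lemma csup_ge0 Q : 0 <= G Q.
Proof. exact: le_trans (g_ge0 (crn Q)) (csup_ub (ccube_corner a L0 Q)). Qed.

Lemma csup_sub Q B : subcube Q B -> G Q <= G B.
Proof. by move=> QB; apply: csup_le => x /(ccube_sub L0 QB); exact: csup_ub. Qed.

Lemma darboux_ge0 N Q : 0 <= A N Q.
Proof.
rewrite -(iter_avg_cst N Q 0); apply: ler_iter_avg => P _; exact: csup_ge0.
Qed.

Lemma darbouxS N Q : A N.+1 Q <= A N Q.
Proof.
elim: N Q => [|N IH] Q.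
  rewrite /darboux /= -[leRHS](avg_cst Q); apply: ler_avg => e.
  exact/csup_sub/subcube_child.
by apply: (@ler_avg _ _ (A N.+1) (A N)) => e; exact: IH.
Qed.

Lemma darboux_nincr N N' Q : (N <= N')%N -> A N' Q <= A N Q.
Proof.
by move=> /subnKC <-; elim: (N' - N)%N => [|k IH]; rewrite ?addn0// addnS (le_trans (darbouxS _ _)).
Qed.

Lemma umean_le N Q : M Q <= A N Q.
Proof.
apply: ge_inf; last by exists N.
by exists 0 => _ [k _ <-]; exact: darboux_ge0.
Qed.

Lemma umean_le_csup Q : M Q <= G Q. Proof. exact: (umean_le 0). Qed.

Lemma umean_ge0 Q : 0 <= M Q.
Proof.
apply: lb_le_inf; first by exists (A 0 Q); exists 0%N.
by move=> _ [k _ <-]; exact: darboux_ge0.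
Qed.

Lemma umean_le_bound Q : M Q <= Lam.
Proof. by apply: le_trans (umean_le_csup Q) _; apply: csup_le => x _; exact/ltW. Qed.

(** The bound persists for larger [N], which lets several cubes share one [N]. *)
Lemma umean_approx Q (e : R) : 0 < e ->
  exists N0, forall N, (N0 <= N)%N -> A N Q <= M Q + e.
Proof.
move=> e0; have [|_ [N0 _ <-] N0e] := @inf_adherent _ (range (fun N => A N Q)) _ e0.
  split; first by exists (A 0 Q); exists 0%N.
  by exists 0 => _ [k _ <-]; exact: darboux_ge0.
by exists N0 => N N0N; apply: le_trans (darboux_nincr Q N0N) (ltW N0e).
Qed.

(** The upper sums decrease under refinement, so the finitely many children can
    be approximated at a common depth. *)
Lemma umean_le_avg Q : M Q <= avg M Q.
Proof.
apply/ler_addgt0Pr => e e0.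
have /choice[N0 N0P] : forall c, exists N0, forall N, (N0 <= N)%N ->
  A N (child Q c) <= M (child Q c) + e by move=> c; exact: umean_approx.
pose N := \max_c N0 c.
apply: le_trans (umean_le N.+1 Q) _.
rewrite -[X in _ <= _ + X](avg_cst Q) -avgD; apply: ler_avg => c.
by apply: N0P; exact: leq_bigmax.
Qed.

Lemma ball_ccube x (e : R) : 0 < e -> exists j0, forall Q, (j0 <= Q.1)%N ->
  cc Q x -> forall y, cc Q y -> ball x e y.
Proof.
move=> e0; have [j0 j0P] := side_small L e0; exists j0 => Q jQ Qx y Qy.
split=> // i k; rewrite (ord1 i) /ball /= ltr_norml.
have /andP[x1 x2] := Qx k; have /andP[y1 y2] := Qy k; have := j0P _ jQ.
move: (crn Q _ _) x1 x2 y1 y2 => c *; apply/andP; split; lra.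
Qed.

Lemma csup_usc x (c : R) : g x < c -> exists j0, forall Q, (j0 <= Q.1)%N ->
  cc Q x -> G Q <= c.
Proof.
move=> gxc; have := g_cont (lt_nbhsl gxc).
rewrite nbhs_simpl => /nbhs_ballP[e /= e0 eP].
have [j0 j0P] := ball_ccube x e0; exists j0 => Q jQ Qx.
by apply: csup_le => y Qy; apply/ltW; apply: (eP y); exact: (j0P _ jQ Qx y Qy).
Qed.

(** The common point is the coordinatewise supremum of the lower corners. *)
Lemma nested_ccube (S : nat -> cube n) :
  (forall m, subcube (S m.+1) (S m)) -> exists x, forall m, cc (S m) x.
Proof.
move=> SS; have Sle m m' : (m <= m')%N -> subcube (S m') (S m).
  move=> /subnKC <-; elim: (m' - m)%N => [|k IH]; rewrite ?addn0 ?subcube_refl//.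
  by rewrite addnS; apply: subcube_trans (SS _) IH.
have up m m' i : crn (S m') ord0 i <= crn (S m) ord0 i + sd (S m).1.
  have [mm'|/ltnW mm'] := leqP m m'.
    by have /(_ i)/andP[] := ccube_sub L0 (Sle _ _ mm') (ccube_corner a L0 (S m')).
  have /(_ i)/andP[+ _] := ccube_sub L0 (Sle _ _ mm') (ccube_corner a L0 (S m)).
  by move=> /le_trans; apply; rewrite lerDl side_ge0.
exists (\row_i sup (range (fun m => crn (S m) ord0 i))) => m i; rewrite [X in _ <= X <= _]mxE.
apply/andP; split.
  apply: ub_le_sup; last by exists m.
  by exists (crn (S m) ord0 i + sd (S m).1) => _ [m' _ <-]; exact: up.
by apply: ge_sup; [exists (crn (S m) ord0 i); exists m|move=> _ [m' _ <-]; exact: up].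
Qed.

(** A strict failure of the inequality is inherited by some child, because the
    left-hand side is subadditive and the right-hand side superadditive under
    subdivision. It is hence inherited by all cubes of a sequence shrinking to a
    point [x]. If [g x < thr], the means over these cubes finally are at most
    [thr]; otherwise the cubes finally lie in a cube of the list whose weight
    exceeds [g x], hence also [g] near [x]. Both contradict the failure. *)
Lemma umean_le_cap (thr : R) (W : seq (R * cube n)) D :
  0 <= thr -> (forall w, w \in W -> 0 <= w.1) -> subcube D (topcube n) ->
  (forall x, thr <= g x -> exists w, g x < w /\ exists j0, forall Q,
     subcube Q (topcube n) -> (j0 <= Q.1)%N -> cc Q x ->
     exists B, (w, B) \in W /\ subcube Q B) ->
  (M D - thr) * vol L D <= \sum_(w <- W) w.1 * cap L D w.2.
Proof.
move=> thr0 W0 Droot Wcov.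
pose psi Q := \sum_(w <- W) w.1 * cap L Q w.2.
have psi0 Q : 0 <= psi Q.
  by rewrite /psi big_seq sumr_ge0// => w /W0 w0; rewrite mulr_ge0// cap_ge0.
rewrite leNgt; apply/negP => Dbad.
pose bad Q := psi Q < (M Q - thr) * vol L Q.
have badchild Q : bad Q -> exists e, bad (child Q e).
  move=> Qbad; apply/existsP; apply: contraT; rewrite negb_exists => /forallP good.
  move: Qbad; rewrite /bad ltNge => /negP[].
  apply: le_trans (_ : \sum_e psi (child Q e) <= _).
    apply: le_trans (_ : \sum_e (M (child Q e) - thr) * vol L (child Q e) <= _); last first.
      by apply: ler_sum => e _; rewrite leNgt; exact: good.
    rewrite (eq_bigr (fun e => (M (child Q e) - thr) * (2^-1 ^+ n * vol L Q))); last first.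
      move=> e _; rewrite (vol_child L Q e) [X in _ = _ * X]mulrA -exprMn.
      by rewrite mulVf ?expr1n ?mul1r// pnatr_eq0.
    rewrite -mulr_suml mulrA ler_wpM2r ?(ltW (vol_gt0 L0 _))// mulrC.
    rewrite -/(avg (fun P => M P - thr) Q) avgB avg_cst lerB//.
    exact: umean_le_avg.
  rewrite /psi exchange_big /= big_seq [leRHS]big_seq; apply: ler_sum => w /W0 w0.
  by rewrite -mulr_sumr ler_wpM2l// cap_children.
pose step Q := if [pick e | bad (child Q e)] is Some e then child Q e else Q.
have stepP Q : bad Q -> bad (step Q) /\ exists e, step Q = child Q e.
  move=> /badchild[e0 be0]; rewrite /step; case: pickP => [e be|/(_ e0)]; last by rewrite be0.
  by split => //; exists e.
pose S m := iter m step D.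
have badS m : bad (S m) by elim: m => [//|m IH]; rewrite /S iterS; apply: (stepP _ IH).1.
have SS m : exists e, S m.+1 = child (S m) e by rewrite {1}/S iterS; apply: (stepP _ (badS m)).2.
have subS m : subcube (S m.+1) (S m) by have [e ->] := SS m; exact: subcube_child.
have Slev m : (m <= (S m).1)%N.
  by elim: m => [//|m IH]; have [e ->] := SS m; exact: IH.
have Sroot m : subcube (S m) (topcube n).
  by elim: m => [//|m IH]; exact: subcube_trans (subS m) IH.
have [x xS] := nested_ccube subS.
have [gx|/Wcov[w [gxw [j0 wP]]]] := ltP (g x) thr.
  have [j0 j0P] := csup_usc gx.
  have := badS j0; rewrite /bad ltNge => /negP[].
  apply: le_trans (psi0 _); rewrite mulr_le0_ge0 ?(ltW (vol_gt0 L0 _))//.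
  rewrite -[leLHS]opprK oppr_le0 opprB subr_ge0.
  exact: le_trans (umean_le_csup _) (j0P _ (Slev j0) (xS j0)).
have [j1 j1P] := csup_usc gxw.
pose m := maxn j0 j1.
have [B [BW SB]] := wP _ (Sroot m) (leq_trans (leq_maxl _ _) (Slev m)) (xS m).
have := badS m; rewrite /bad ltNge => /negP[].
apply: le_trans (_ : w * vol L (S m) <= _).
  rewrite ler_wpM2r ?(ltW (vol_gt0 L0 _))// lerBlDr ler_wpDr//.
  apply: le_trans (umean_le_csup _) (j1P _ _ (xS m)).
  exact: leq_trans (leq_maxr _ _) (Slev m).
rewrite /psi (big_rem _ BW) /= {1}/cap SB lerDl big_seq sumr_ge0// => v /mem_rem /W0 v0.
by rewrite mulr_ge0// cap_ge0.
Qed.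

End UpperMean.

(** * Three inequalities on finite sums *)

Section Aux.
Variable R : realType.

(** Either some term exceeds 1, and so does its power, or the exponent [s <= 1]
    increases every term. *)
Lemma sum_powR_ge1 (T : Type) (r : seq T) (P : pred T) (y : T -> R) (s : R) :
  0 < s <= 1 -> (forall x, 0 <= y x) ->
  1 <= \sum_(x <- r | P x) y x -> 1 <= \sum_(x <- r | P x) y x `^ s.
Proof.
move=> /andP[s0 s1] y0 y1.
have ys0 (Q : pred T) (q : seq T) : 0 <= \sum_(x <- q | Q x) y x `^ s.
  by apply: sumr_ge0 => *; exact: powR_ge0.
have [le1|] := boolP (all (fun x => P x ==> (y x <= 1)) r).
  apply: le_trans y1 _; elim: r le1 {ys0} => [|x r IH]; first by rewrite !big_nil.
  move=> /= /andP[x1 /IH r1]; rewrite !big_cons.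
  case: ifP x1 => //= _ x1; apply: lerD => //.
  have [->|yx] := eqVneq (y x) 0; first by rewrite powR0// gt_eqF.
  by apply: ger1_powR => //; rewrite lt0r yx y0 x1.
elim: r {y1} => [//|x r IH]; rewrite /= negb_and big_cons.
have [_ /IH r1|xbad _] := boolP (P x ==> (y x <= 1)).
  by case: ifP => // _; rewrite (le_trans r1)// lerDr powR_ge0.
move: xbad; rewrite negb_imply -ltNge => /andP[-> yx].
rewrite (le_trans _ (_ : y x `^ s <= _))// ?lerDl//.
have: 1 `^ s <= y x `^ s by rewrite ge0_ler_powR ?nnegrE// ltW.
by rewrite powR1.
Qed.

Lemma sum_at_most_one (T : eqType) (r : seq T) (P : pred T) (t : R) :
  0 <= t -> uniq r ->
  (forall x y, x \in r -> y \in r -> P x -> P y -> x = y) ->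
  \sum_(x <- r | P x) t <= t.
Proof.
move=> t0; elim: r => [|x r IH]; first by rewrite big_nil.
move=> /= /andP[xr ur] Puniq; rewrite big_cons; case: ifP => Px; last first.
  by apply: IH => // y z yr zr; apply: Puniq; rewrite inE ?yr ?zr orbT.
rewrite big_seq_cond big1 ?addr0// => y /andP[yr Py].
by move: xr; rewrite (Puniq x y) ?inE ?eqxx ?yr ?orbT.
Qed.

(** The convolution [w] satisfies w (k+1) = rho w k + x (k+1); adding rho w K to
    the left-hand side makes the induction go through. *)
Lemma sum_geom_conv (rho : R) (x : nat -> R) K : 0 <= rho < 1 ->
  (forall i, 0 <= x i) ->
  (1 - rho) * \sum_(k < K) \sum_(i < k.+2) rho ^+ (k.+1 - i) * x i
  <= \sum_(i < K.+1) x i.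
Proof.
move=> /andP[rho0 rho1] x0.
pose w k := \sum_(i < k.+1) rho ^+ (k - i) * x i.
have w0 k : 0 <= w k by apply: sumr_ge0 => i _; rewrite mulr_ge0// exprn_ge0.
have wS k : w k.+1 = rho * w k + x k.+1.
  rewrite {1}/w big_ord_recr /= subnn expr0 mul1r; congr (_ + _).
  rewrite /w mulr_sumr; apply: eq_bigr => i _.
  by rewrite mulrA -exprS subSn// -ltnS.
rewrite -/(w _.+1) -[X in _ * X]/(\sum_(k < K) w k.+1).
suff: (1 - rho) * (\sum_(k < K) w k.+1) + rho * w K <= \sum_(i < K.+1) x i.
  by apply: le_trans; rewrite lerDl mulr_ge0.
elim: K => [|K IH].
  rewrite big_ord0 mulr0 add0r /w !big_ord1 /= subnn expr0 mul1r.
  by rewrite ler_piMl// ltW.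
rewrite [\sum_(k < K.+1) _]big_ord_recr [\sum_(i < K.+2) _]big_ord_recr /=.
by have := wS K; nra.
Qed.

End Aux.

(** * Stopping cubes *)

(** Small cubes touching a point of [E], and not only the point, have to lie in a
    cube of the list: the limit point of a nested sequence of cubes may be on the
    boundary of all of them. *)
Definition strong_cover (R : realType) (n : nat) (a : 'rV[R]_n) (L : R)
  (E : set 'rV[R]_n) (Bs : seq (cube n)) : Prop :=
  forall x, E x -> exists j0, forall Q, subcube Q (topcube n) ->
    (j0 <= Q.1)%N -> ccube a L Q x -> exists B, B \in Bs /\ subcube Q B.

Section Stopping.
Variables (R : realType) (n : nat) (a : 'rV[R]_n) (L : R).
Hypothesis L0 : 0 < L.
Variables (g : 'rV[R]_n -> R) (Lam : R).
Hypothesis g_ge0 : forall x, 0 <= g x.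
Hypothesis g_lt : forall x, g x < Lam.
Hypothesis g_cont : continuous g.
Implicit Types (Q B D : cube n) (z : 'rV[R]_n).
Local Notation sd := (side L).
Local Notation M := (umean a L g).

Definition level (i : nat) : R := Lam / 2 ^+ i.
Variable Bs : nat -> seq (cube n).
Hypothesis Bs_cover : forall i, strong_cover a L [set x | level i <= g x] (Bs i).
Variable delta : R.
Hypothesis delta_gt0 : 0 < delta.
Hypothesis delta_le : delta <= n%:R.
Local Notation s := (delta / n%:R).

Lemma Lam_gt0 : 0 < Lam. Proof. exact: le_lt_trans (g_ge0 0) (g_lt 0). Qed.

Lemma level_gt0 i : 0 < level i.
Proof. by rewrite divr_gt0 ?exprn_gt0// Lam_gt0. Qed.

Lemma level0 : level 0 = Lam.
Proof. by rewrite /level expr0 divr1. Qed.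

Lemma levelS i : level i = 2 * level i.+1.
Proof. by rewrite /level exprS; field; rewrite expf_neq0. Qed.

Lemma levelD i d : level i = level (i + d) * 2 ^+ d.
Proof. by rewrite /level exprD; field; rewrite !expf_neq0. Qed.

Definition cover_upto k : seq (nat * cube n) :=
  [seq (i, B) | i <- iota 0 k.+2, B <- Bs i].

Lemma cover_uptoP k i B : (i, B) \in cover_upto k <-> (i < k.+2)%N /\ B \in Bs i.
Proof.
split=> [/allpairsPdep[i' [B' [ii' BB' [-> ->]]]]|[ik Bi]].
  by move: ii'; rewrite mem_iota add0n.
by apply/allpairsPdep; exists i, B; rewrite mem_iota.
Qed.

Definition selected k Q : Prop :=
  level k < M Q \/ exists i, (i, Q) \in cover_upto k.

(** The maximal selected cubes. For delta < n the sum of side^delta over disjoint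
    cubes inside a covering cube B may exceed side(B)^delta, so a covering cube
    has to replace the smaller cubes of large mean that it contains. *)
Definition stopping k : set (cube n) := [set D | [/\ subcube D (topcube n),
  selected k D & forall j, (j < D.1)%N -> ~ selected k (anc j D)]].

Lemma stopping_cover k Q : subcube Q (topcube n) -> level k < M Q ->
  exists2 D, stopping k D & subcube Q D.
Proof.
move=> Qtop kQ; pose P j := (j <= Q.1)%N && `[< selected k (anc j Q) >].
have exP : exists j, P j.
  by exists Q.1; rewrite /P leqnn anc_self; apply/asboolP; left.
case: (ex_minnP exP) => j /andP[jQ /asboolP jsel] jmin.
exists (anc j Q); last exact: subcube_anc.
split => //.
  exact: (subcube_nested Qtop (subcube_anc jQ)).
move=> j' /= j'j; rewrite anc_anc ?(ltnW j'j)//= => sel.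
have : (j <= j')%N by apply: jmin; rewrite /P (leq_trans (ltnW j'j) jQ); apply/asboolP.
by rewrite leqNgt j'j.
Qed.

Lemma stopping_uniq k B D D' : stopping k D -> stopping k D' ->
  subcube B D -> subcube B D' -> D = D'.
Proof.
wlog DD' : D D' / (D.1 <= D'.1)%N.
  move=> W sD sD' BD BD'; have [|/ltnW] := leqP D.1 D'.1; first by move=> ?; exact: W.
  by move=> ?; apply/esym; exact: W.
move=> [_ selD _] [_ _ maxD'] BD BD'.
have D'D := subcube_nested BD BD' DD'.
apply/esym/subcube_eq => //; apply/eqP; rewrite eqn_leq DD' andbT leqNgt.
apply/negP => /maxD'; apply.
by rewrite -(subcubeE D'D).
Qed.

Let n_gt0 : (0 < n)%N.
Proof. by rewrite -(ltr0n R); exact: lt_le_trans delta_gt0 delta_le. Qed.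

Let s_bnd : 0 < s <= 1.
Proof. by rewrite divr_gt0 ?ltr0n//= ler_pdivrMr ?ltr0n// mul1r. Qed.

(** The share of the covering cube [x.2], of level [x.1], in the size of the
    stopping cube of level [k] that contains it. *)
Definition cost k (x : nat * cube n) : R :=
  (2 `^ s) ^+ (k.+2 - x.1) * sd x.2.1 `^ delta.

Lemma cost_ge0 k (x : nat * cube n) : 0 <= cost k x.
Proof. by rewrite mulr_ge0 ?exprn_ge0// powR_ge0. Qed.

(** For a stopping cube D of large mean, [umean_le_cap] with weights
    2 (level i) compares the volume of D with those of the covering cubes inside
    it; by [sum_powR_ge1] the comparison survives the power delta/n, which turns
    volumes into side^delta. *)
Lemma stopping_size k D : stopping k D ->
  sd D.1 `^ delta <= \sum_(x <- cover_upto k | subcube x.2 D) cost k x.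
Proof.
move=> [Dtop selD maxD].
have [[i iD]|notB] := pselect (exists i, (i, D) \in cover_upto k).
  rewrite (big_rem _ iD) /= subcube_refl.
  rewrite (le_trans _ (_ : cost k (i, D) <= _)) ?lerDl ?sumr_ge0//; last first.
    by move=> *; exact: cost_ge0.
  rewrite ler_peMl ?powR_ge0// exprn_ege1//.
  have: 2 `^ 0 <= (2:R) `^ s by rewrite ler_powR ?ler1n//; case/andP: s_bnd => /ltW.
  by rewrite powRr0.
case: selD => // kD.
(* The least [i] with [level i <= g x] satisfies [g x < 2 * level i], which is why
   the weights are twice the levels. *)
pose W := [seq (2 * level y.1, y.2) | y <- cover_upto k].
have W0 w : w \in W -> 0 <= w.1.
  by move=> /mapP[[i B] _ ->] /=; rewrite mulr_ge0// ltW// level_gt0.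
have Wcov (x : 'rV[R]_n) : level k.+1 <= g x -> exists w, g x < w /\ exists j0, forall Q,
     subcube Q (topcube n) -> (j0 <= Q.1)%N -> ccube a L Q x ->
     exists B, (w, B) \in W /\ subcube Q B.
  move=> xk.
  have ex : exists i, (i < k.+2)%N && (level i <= g x) by exists k.+1; rewrite leqnn.
  case: (ex_minnP ex) => i /andP[ik ix] imin.
  exists (2 * level i); split.
    case: i ik ix imin => [|i] ik ix imin.
      by move: ix; rewrite level0 leNgt g_lt.
    rewrite -levelS ltNge; apply/negP => ix'.
    by have := imin i; rewrite ix' (ltnW ik) ltnn => /(_ isT).
  have [j0 j0P] := Bs_cover ix; exists j0 => Q Qtop jQ Qx.
  have [B [BB QB]] := j0P Q Qtop jQ Qx; exists B; split => //.
  by apply/mapP; exists (i, B) => //; apply/cover_uptoP.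
have Dcap := umean_le_cap L0 g_ge0 g_lt g_cont (ltW (level_gt0 _)) W0 Dtop Wcov.
have vD := vol_gt0 L0 D.
have capE (x : nat * cube n) : x \in cover_upto k ->
    cap L D x.2 = if subcube x.2 D then vol L x.2 else 0.
  move=> xk; rewrite /cap; case: ifPn => // Dx; exfalso.
  have := subcube_level Dx; rewrite leq_eqVlt => /orP[/eqP xD|xD].
    by apply: notB; exists x.1; rewrite (subcube_eq Dx)// -surjective_pairing.
  apply: (maxD _ xD); right; exists x.1.
  by rewrite -(subcubeE Dx) -surjective_pairing.
pose y (x : nat * cube n) := 2 ^+ (k.+2 - x.1) * (sd x.2.1 / sd D.1) ^+ n.
have y0 (x : nat * cube n) : 0 <= y x.
  by rewrite mulr_ge0 ?exprn_ge0// divr_ge0// side_ge0.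
have : 1 <= \sum_(x <- cover_upto k | subcube x.2 D) y x.
  have lk := level_gt0 k.+1.
  rewrite -(ler_pM2l (mulr_gt0 lk vD)) mulr1.
  apply: le_trans (_ : (M D - level k.+1) * vol L D <= _).
    by rewrite ler_wpM2r ?(ltW vD)//; have := levelS k; lra.
  apply: le_trans Dcap _; rewrite /W big_map mulr_sumr [leRHS]big_mkcond /=.
  rewrite big_seq [leRHS]big_seq; apply: ler_sum => -[i B] iB.
  rewrite capE //=; case: ifP => _; last by rewrite mulr0.
  have /cover_uptoP[ik _] := iB.
  rewrite le_eqVlt; apply/orP; left; apply/eqP.
  rewrite /y /= /vol (expr_div_n (sd B.1) (sd D.1)).
  rewrite (levelD i (k.+1 - i)) subnKC; last by rewrite -ltnS.
  rewrite (_ : k.+2 - i = (k.+1 - i).+1)%N; last by rewrite subSn// -ltnS.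
  rewrite exprS; have : sd D.1 ^+ n != 0 by rewrite expf_neq0// gt_eqF ?side_gt0.
  move: (sd D.1 ^+ n) (sd B.1 ^+ n) (2 ^+ (k.+1 - i)) (level k.+1) => u v w z u0.
  by field.
move=> /(sum_powR_ge1 s_bnd y0).
have sdp : 0 < sd D.1 `^ delta by rewrite powR_gt0 ?side_gt0.
rewrite -(ler_pM2l sdp) mulr1 => /le_trans; apply.
rewrite mulr_sumr; apply: ler_sum => x _.
have sx := side_ge0 L0 x.2.1; have sD := side_gt0 L0 D.1.
rewrite le_eqVlt; apply/orP; left; apply/eqP.
have rho0 : 0 <= sd x.2.1 / sd D.1 by rewrite divr_ge0// ltW.
have e1 m : (2 ^+ m) `^ s = ((2 : R) `^ s) ^+ m.
  by rewrite -powR_mulrn// -powRrM mulrC [LHS]powRrM powR_mulrn// powR_ge0.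
have e2 : ((sd x.2.1 / sd D.1) ^+ n) `^ s = (sd x.2.1 / sd D.1) `^ delta.
  rewrite -powR_mulrn// -powRrM; congr (_ `^ _).
  by field; rewrite pnatr_eq0 -lt0n.
rewrite /y /cost powRM ?exprn_ge0// e1 e2 mulrC -mulrA; congr (_ * _).
by rewrite -powRM ?(ltW sD)// divfK// gt_eqF.
Qed.

(** Each covering cube lies in at most one stopping cube. *)
Lemma stopping_sum k (X : seq (cube n)) : uniq X ->
  (forall D, D \in X -> stopping k D) ->
  \sum_(D <- X) sd D.1 `^ delta <= \sum_(x <- cover_upto k) cost k x.
Proof.
move=> uX Xk.
apply: le_trans (_ : \sum_(D <- X) \sum_(x <- cover_upto k | subcube x.2 D) cost k x <= _).
  by rewrite big_seq [leRHS]big_seq; apply: ler_sum => D /Xk; exact: stopping_size.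
under eq_bigr do rewrite big_mkcond.
rewrite exchange_big /=; apply: ler_sum => x _.
rewrite -big_mkcond; apply: sum_at_most_one => //; first exact: cost_ge0.
by move=> D D' /Xk kD /Xk kD'; exact: (stopping_uniq kD kD').
Qed.

Definition cover_size i : R := \sum_(B <- Bs i) sd B.1 `^ delta.

Lemma sum_costE k : \sum_(x <- cover_upto k) cost k x =
  \sum_(i < k.+2) (2 `^ s) ^+ (k.+2 - i) * cover_size i.
Proof.
rewrite /cover_upto big_allpairs_dep.
have -> : iota 0 k.+2 = index_iota 0 k.+2 by rewrite /index_iota subn0.
rewrite big_mkord.
by apply: eq_bigr => i _; rewrite /cost /= -mulr_sumr.
Qed.

Variable p : R.
Hypothesis p_gt : s < p.

Definition level_ratio : R := 2 `^ s * 2 `^ (- p).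

Lemma level_ratio_bnd : 0 < level_ratio < 1.
Proof.
rewrite /level_ratio mulr_gt0 ?powR_gt0//= -powRD; last by rewrite pnatr_eq0 implybT.
have: (2 : R) `^ (s - p) <= 2 `^ 0 by rewrite ler_powR ?ler1n// subr_le0 ltW.
rewrite powRr0 lt_neqAle => ->; rewrite powR_eq1 andbT subr_eq0 (lt_eqF p_gt).
by rewrite orbF negb_or gt_eqF ?ltr1n//= -leNgt ler0n.
Qed.

(** Up to a constant the left-hand side is the sum of a convolution with the powers
    of [level_ratio], which is less than 1 because p > delta/n. *)
Lemma sum_level_cost K V :
  (forall i, \sum_(j < i) level j `^ p * cover_size j <= V) ->
  \sum_(k < K) level k `^ p * \sum_(x <- cover_upto k) cost k x
  <= 2 `^ s * 2 `^ p / (1 - level_ratio) * V.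
Proof.
move=> HV; have /andP[r0 r1] := level_ratio_bnd.
pose x i := level i `^ p * cover_size i.
have x0 i : 0 <= x i.
  by rewrite mulr_ge0 ?powR_ge0// sumr_ge0// => *; exact: powR_ge0.
have lE i : level i `^ p = Lam `^ p * (2 `^ (- p)) ^+ i.
  rewrite /level powRM ?invr_ge0 ?exprn_ge0 ?(ltW Lam_gt0)//; congr (_ * _).
  rewrite -!powR_mulrn ?powR_ge0// -powRN -!powRrM; congr (_ `^ _); lra.
have tp : (2 : R) `^ p * 2 `^ (- p) = 1.
  by rewrite powRN mulfV// gt_eqF ?powR_gt0.
have -> : \sum_(k < K) level k `^ p * \sum_(y <- cover_upto k) cost k y =
    2 `^ s * 2 `^ p * \sum_(k < K) \sum_(i < k.+2) level_ratio ^+ (k.+1 - i) * x i.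
  rewrite mulr_sumr; apply: eq_bigr => k _.
  rewrite sum_costE !mulr_sumr; apply: eq_bigr => i _.
  rewrite /x !lE /level_ratio exprMn.
  have ik : (i <= k.+1)%N by rewrite -ltnS.
  rewrite (subSn ik) exprS.
  have -> : (2 `^ (- p)) ^+ k = 2 `^ p * ((2 : R) `^ (- p)) ^+ (k.+1 - i + i).
    by rewrite subnK// exprS mulrA tp mul1r.
  by rewrite exprD; ring.
rewrite -[leRHS]mulrA ler_wpM2l ?mulr_ge0 ?powR_ge0//.
rewrite -(mulrC V) ler_pdivlMr ?subr_gt0// mulrC.
by apply: le_trans (sum_geom_conv _ _ x0) (HV _); rewrite ltW.
Qed.

End Stopping.

(** * Pointwise bound by telescoping averages *)

(** The branch of cubes containing [x]: a point on a face shared by two children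
    goes to the upper one. *)
Fixpoint cube_at (R : realType) (n : nat) (a : 'rV[R]_n) (L : R) (x : 'rV[R]_n)
    (j : nat) : cube n :=
  if j is k.+1 then let Q := cube_at a L x k in
    child Q [ffun i => corner a L Q ord0 i + side L k.+1 <= x ord0 i]
  else topcube n.

Section Pointwise.
Variables (R : realType) (n : nat) (a : 'rV[R]_n) (L : R).
Hypothesis L0 : 0 < L.
Variables (g : 'rV[R]_n -> R) (Lam : R).
Hypothesis g_ge0 : forall x, 0 <= g x.
Hypothesis g_lt : forall x, g x < Lam.
Variable u : 'rV[R]_n -> R.
Hypothesis u_cont : continuous u.
Hypothesis u_lip : forall x (i : 'I_n) (h c : R), 0 <= h ->
  (forall t, 0 <= t <= h -> g (x + t *: delta_mx ord0 i) <= c) ->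
  `|u (x + h *: delta_mx ord0 i) - u x| <= h * c.
Implicit Types (Q B D : cube n) (x : 'rV[R]_n).
Local Notation sd := (side L).
Local Notation crn := (corner a L).
Local Notation cc := (ccube a L).
Local Notation G := (csup a L g).
Local Notation A := (darboux a L g).
Local Notation M := (umean a L g).
Local Notation U N := (iter N (@avg R n) (fun P => u (crn P))).

Lemma shiftcD (i : 'I_n) (s t : nat) (z : {ffun 'I_n -> nat}) :
  shiftc i s (shiftc i t z) = shiftc i (t + s) z.
Proof. by apply/ffunP => k; rewrite !ffunE; lia. Qed.

Lemma corner_shift j z i : crn (j, shiftc i 1 z) = crn (j, z) + sd j *: delta_mx ord0 i.
Proof.
apply/rowP => k; by rewrite /corner !mxE /= ffunE muln1 natrD mulrDr addrA.
Qed.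

Lemma corner_step j z i :
  `|u (crn (j, shiftc i 1 z)) - u (crn (j, z))| <= sd j * G (j, z).
Proof.
rewrite corner_shift; apply: u_lip; first exact: side_ge0.
move=> t /andP[t0 tj]; apply: (csup_ub g_lt) => k.
rewrite !mxE /=; case: eqP => _ /=; rewrite ?mulr1 ?mulr0 ?addr0.
  by rewrite lerDl t0 lerD2l.
by rewrite lexx lerDl side_ge0.
Qed.

Lemma corner_steps j z i K : `|u (crn (j, shiftc i K z)) - u (crn (j, z))|
  <= \sum_(t < K) sd j * G (j, shiftc i t z).
Proof.
elim: K => [|K IH].
  rewrite big_ord0 (_ : shiftc i 0 z = z) ?subrr ?normr0//.
  by apply/ffunP => k; rewrite ffunE muln0 addn0.
rewrite big_ord_recr /= -addn1 -shiftcD.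
rewrite -(subrKA (u (crn (j, shiftc i K z)))) addrC.
apply: le_trans (ler_normD _ _) _; apply: lerD => //; exact: corner_step.
Qed.

(** Join corresponding lattice points of the two cubes by 2^N steps of length
    side / 2^N. The points visited after t steps form a shifted window, which
    [window_le] controls by the two cubes; summing over t restores the side. *)
Lemma avg_adjacent N j z i :
  `|U N (j, shiftc i 1 z) - U N (j, z)| <=
  sd j * (A N (j, z) + A N (j, shiftc i 1 z)).
Proof.
rewrite /darboux !iter_avgE /= -mulrBr -mulrDr normrM ger0_norm ?exprn_ge0 ?invr_ge0//.
rewrite mulrCA ler_wpM2l ?exprn_ge0 ?invr_ge0// -sumrB.
apply: le_trans (ler_norm_sum _ _ _) _.
set K := (2 ^ N)%N; pose h := sd (j + N).
have K0 : (0 < K)%N by rewrite expn_gt0.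
pose y (w : {ffun 'I_n -> 'I_K}) : {ffun 'I_n -> nat} := [ffun k => w k + z k * K]%N.
apply: le_trans (_ : \sum_w \sum_(t < K) h * G ((j + N)%N, shiftc i t (y w)) <= _).
  apply: ler_sum => w _.
  rewrite (_ : [ffun i0 => (w i0 + shiftc i 1 z i0 * K)%N] = shiftc i K (y w)).
    exact: corner_steps.
  by apply/ffunP => k; rewrite !ffunE; lia.
rewrite exchange_big /= (sideD L j N) -/h -/K.
under eq_bigr do rewrite -mulr_sumr.
rewrite -mulr_sumr -[leRHS]mulrA ler_wpM2l ?side_ge0//.
set S := (X in _ * X); apply: le_trans (_ : \sum_(t < K) S <= _); last first.
  by rewrite sumr_const card_ord mulr_natl.
apply: ler_sum => t _.
apply: (@window_le _ _ _ _ z t (fun z' => G ((j + N)%N, z'))) => // z'.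
exact: (csup_ge0 _ L0 g_ge0 g_lt).
Qed.

Lemma darboux_children N Q : \sum_e A N (child Q e) = 2 ^+ n * A N.+1 Q.
Proof.
by rewrite /darboux iterS /avg mulrA -exprMn mulfV ?expr1n ?mul1r// pnatr_eq0.
Qed.

Lemma avg_flip N Q (e e' : {ffun 'I_n -> bool}) (i : 'I_n) :
  (forall k, k != i -> e k = e' k) ->
  `|U N (child Q e) - U N (child Q e')| <= sd Q.1 * (2 ^+ n * A N.+1 Q).
Proof.
wlog ee' : e e' / (e i <= e' i)%N.
  move=> W ek; have [|/ltnW] := leqP (e i) (e' i); first by move=> ?; exact: W.
  by move=> ?; rewrite distrC; apply: W => // k /ek.
move=> ek; have A0 P : 0 <= A N P by exact: (darboux_ge0 _ L0 g_ge0 g_lt).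
have [eei|] := eqVneq (e i) (e' i).
  rewrite (_ : e = e') ?subrr ?normr0.
    rewrite -darboux_children mulr_ge0 ?side_ge0// sumr_ge0// => *; exact: A0.
  by apply/ffunP => k; have [->//|/ek] := eqVneq k i.
move=> nee; have [ei e'i] : e i = false /\ e' i = true.
  by move: ee' nee; case: (e i); case: (e' i).
rewrite distrC (_ : child Q e' = (Q.1.+1, shiftc i 1 (child Q e).2)); last first.
  congr pair; apply/ffunP => k; rewrite !ffunE muln1.
  by have [->|/ek ->] := eqVneq k i; rewrite ?ei ?e'i; lia.
apply: le_trans (avg_adjacent _ _ _ _) _.
apply: ler_pM; rewrite ?side_ge0 ?addr_ge0 ?side_le//.
rewrite -darboux_children (bigD1 e)//= (bigD1 e')/=; last first.
  by apply: contra nee => /eqP ->.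
rewrite addrA (_ : child Q e' = (Q.1.+1, shiftc i 1 (child Q e).2)); last first.
  congr pair; apply/ffunP => k; rewrite !ffunE muln1.
  by have [->|/ek ->] := eqVneq k i; rewrite ?ei ?e'i; lia.
by rewrite lerDl sumr_ge0// => *; exact: A0.
Qed.

Local Notation Cn := (n%:R * 2 ^+ n : R).

(** Change the coordinates of the sibling one at a time. *)
Lemma avg_siblings N Q e e' :
  `|U N (child Q e) - U N (child Q e')| <= Cn * (sd Q.1 * A N.+1 Q).
Proof.
(* The first [k] coordinates already agree with those of [e']. *)
pose hyb k : {ffun 'I_n -> bool} := [ffun i : 'I_n => if (i < k)%N then e' i else e i].
have hyb0 : hyb 0%N = e by apply/ffunP => i; rewrite ffunE.
have hybn : hyb n = e' by apply/ffunP => i; rewrite ffunE ltn_ord.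
suff H k : (k <= n)%N -> `|U N (child Q (hyb 0%N)) - U N (child Q (hyb k))| <=
    k%:R * (sd Q.1 * (2 ^+ n * A N.+1 Q)).
  have := H n (leqnn n); rewrite hyb0 hybn => /le_trans; apply.
  by rewrite -mulrA (mulrCA (sd _)).
elim: k => [|k IH] kn; first by rewrite subrr normr0 mul0r.
rewrite -(subrKA (U N (child Q (hyb k)))) -natr1 mulrDl mul1r.
apply: le_trans (ler_normD _ _) _; apply: lerD; first exact/IH/ltnW.
apply: (@avg_flip _ _ _ _ (Ordinal kn)) => i ik; rewrite !ffunE.
have -> // : (i < k.+1)%N = (i < k)%N.
by move: ik; rewrite -val_eqE /=; lia.
Qed.

Lemma avg_parent N Q e :
  `|U N (child Q e) - U N.+1 Q| <= Cn * (sd Q.1 * A N.+1 Q).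
Proof.
set b := (X in _ <= X).
rewrite iterS -(avg_cst Q (U N (child Q e))) -avgB.
apply: le_trans (ler_norm_avg _ _) _.
rewrite -[leRHS](avg_cst Q); apply: ler_avg => e'; exact: avg_siblings.
Qed.

Lemma avg_near N Q v (eps : R) : (forall P, subcube P Q -> `|u (crn P) - v| <= eps) ->
  `|U N Q - v| <= eps.
Proof.
move=> H; rewrite ler_distl -(iter_avg_cst N Q (v - eps)) -(iter_avg_cst N Q (v + eps)).
by apply/andP; split; apply: ler_iter_avg => P /H; rewrite ler_distl => /andP[].
Qed.

Local Notation xc := (cube_at a L).

Lemma cube_at_level x j : (xc x j).1 = j.
Proof. by elim: j => //= j ->. Qed.

Lemma cube_at_top x j : subcube (xc x j) (topcube n).
Proof.
elim: j => [|j IH]; first exact: subcube_refl.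
exact: subcube_trans (subcube_child _ _) IH.
Qed.

Lemma corner_child Q e i :
  crn (child Q e) ord0 i = crn Q ord0 i + sd Q.1.+1 * (e i)%:R.
Proof. by rewrite /corner !mxE /= ffunE natrD -mul2n natrM (sideS L Q.1); ring. Qed.

Lemma cube_at_in x j : cc (topcube n) x -> cc (xc x j) x.
Proof.
move=> x0; elim: j => [//|j IH] i.
have /andP[] := IH i.
rewrite (cube_at_level x j) (cube_at_level x j.+1) (sideS L j).
rewrite [xc x j.+1]/= corner_child ffunE cube_at_level.
by case: (leP (crn (xc x j) ord0 i + sd j.+1) (x ord0 i)) => /= *; apply/andP; split; lra.
Qed.

Hypothesis n_gt0 : (0 < n)%N.
Hypothesis u_supp : forall x, u x != 0 -> forall i,
  a ord0 i <= x ord0 i < a ord0 i + sd 1.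

(** The points of this child have coordinates at least a_i + L / 2, so [u]
    vanishes there. *)
Lemma avg_far N : U N (child (topcube n) [ffun=> true]) = 0.
Proof.
apply/eqP; rewrite -normr_eq0 eq_le normr_ge0 andbT -[U N _]subr0.
apply: avg_near => P Pfar; rewrite subr0 normr_le0.
apply: contraT => /u_supp /(_ (Ordinal n_gt0)) /andP[_].
have /(_ (Ordinal n_gt0)) := ccube_sub L0 Pfar (ccube_corner a L0 P).
move=> /andP[+ _]; rewrite [X in X <= _]mxE /= !ffunE addn0 mulr1.
by rewrite leNgt => /negPf ->.
Qed.

(** Telescoping, started at the sibling of [avg_far] where averages vanish. *)
Lemma avg_chain x N m : `|U N (xc x m.+1)| <=
  Cn * \sum_(j < m.+1) sd j * A (N + (m.+1 - j)) (xc x j).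
Proof.
elim: m N => [|m IH] N.
  rewrite big_ord1 subn0 addn1 -[U N _]subr0 -(avg_far N).
  by have := avg_siblings N (topcube n)
    [ffun i => corner a L (topcube n) ord0 i + side L 1 <= x ord0 i] [ffun=> true].
rewrite big_ord_recr /= mulrDr -[U N _](subrK (U N.+1 (xc x m.+1))) addrC.
apply: le_trans (ler_normD _ _) _; apply: lerD.
  apply: le_trans (IH N.+1) _; rewrite ler_wpM2l ?mulr_ge0 ?exprn_ge0 ?ler0n//.
  apply: ler_sum => j _; rewrite (_ : N.+1 + (m.+1 - j) = N + (m.+2 - j))%N//.
  by have := ltn_ord j; lia.
have := avg_parent N (xc x m.+1)
  [ffun i => corner a L (xc x m.+1) ord0 i + sd m.+2 <= x ord0 i].
by rewrite subSnn addn1 cube_at_level.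
Qed.

(** The averages of [u] over a small cube around [x] are close to [u x], and the
    upper sums in [avg_chain] are close to the upper means for large [N]. *)
Lemma pointwise_bound x (eps : R) : u x != 0 -> 0 < eps ->
  exists m, `|u x| <= eps + Cn * \sum_(j < m) sd j * M (xc x j).
Proof.
move=> ux eps0.
have xtop : cc (topcube n) x.
  move=> i; have /andP[lo hi] := u_supp ux i.
  rewrite !mxE /= ffunE mulr0 addr0 lo /= (ltW (lt_le_trans hi _))// lerD2l.
  exact: side_le.
pose e2 := eps / 2; have e20 : 0 < e2 by rewrite divr_gt0.
have := u_cont (nbhsx_ballx (u x) _ e20).
rewrite nbhs_simpl => /nbhs_ballP[r /= r0 rP].
have [j0 j0P] := ball_ccube a L x r0.
pose m := j0; exists m.+1.
pose w := Cn * \sum_(j < m.+1) sd j.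
have w0 : 0 <= w.
  by rewrite mulr_ge0 ?sumr_ge0// ?mulr_ge0 ?exprn_ge0 ?ler0n// => *; exact: side_ge0.
pose e3 := e2 / (w + 1); have e30 : 0 < e3 by rewrite divr_gt0// ltr_wpDl.
have /choice[N0 N0P] : forall j, exists N0, forall N, (N0 <= N)%N ->
    A N (xc x j) <= M (xc x j) + e3.
  by move=> j; apply: (umean_approx _ L0 g_ge0 g_lt).
pose N := \max_(j < m.+1) N0 j.
have near : `|U N (xc x m.+1) - u x| <= e2.
  apply: avg_near => P Px; rewrite distrC ltW//.
  apply: rP; apply: (j0P (xc x m.+1)); rewrite ?cube_at_level//; first exact: cube_at_in.
  exact: (ccube_sub L0 Px (ccube_corner a L0 P)).
rewrite -[u x](subrK (U N (xc x m.+1))) [eps]splitr -/e2 -[leRHS]addrA.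
apply: le_trans (ler_normD _ _) _; rewrite distrC lerD//.
apply: le_trans (avg_chain _ _ _) _.
apply: le_trans (_ : Cn * \sum_(j < m.+1) sd j * (M (xc x j) + e3) <= _).
  rewrite ler_wpM2l ?mulr_ge0 ?exprn_ge0 ?ler0n//; apply: ler_sum => j _.
  rewrite ler_wpM2l ?side_ge0//; apply: N0P.
  by apply: leq_trans (leq_addr _ _); exact: (leq_bigmax (F := fun j : 'I_m.+1 => N0 j)).
rewrite (eq_bigr (fun j : 'I_m.+1 => sd j * M (xc x j) + sd j * e3)) => [|j _];
  last by rewrite mulrDr.
rewrite big_split /= mulrDr [leRHS]addrC lerD2l -mulr_suml mulrA -/w.
by rewrite /e3 mulrCA ler_piMr ?(ltW e20)// ler_pdivrMr ?ltr_wpDl// mul1r lerDl.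
Qed.

End Pointwise.

(** * Hausdorff content and dyadic covers *)

Section Enorm.
Variables (R : realType) (n : nat).
Implicit Types x y : 'rV[R]_n.

Lemma coord_le_enorm x i : `|x ord0 i| <= enorm x.
Proof.
rewrite /enorm -sqrtr_sqr ler_wsqrtr// (bigD1 i)//= lerDl.
by apply: sumr_ge0 => *; exact: sqr_ge0.
Qed.

Lemma enorm_le x (b : R) : (forall i, `|x ord0 i| <= b) -> enorm x <= n%:R * b.
Proof.
case: n x => [x _|m x xb]; first by rewrite /enorm big_ord0 sqrtr0 mul0r.
have b0 : 0 <= b := le_trans (normr_ge0 _) (xb ord0).
rewrite -(ler_sqr) ?nnegrE ?sqrtr_ge0 ?mulr_ge0// sqr_sqrtr; last first.
  by apply: sumr_ge0 => *; exact: sqr_ge0.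
apply: le_trans (_ : \sum_(i < m.+1) b ^+ 2 <= _).
  by apply: ler_sum => i _; rewrite -real_normK ?num_real// lerXn2r ?nnegrE.
rewrite sumr_const card_ord -(mulr_natl (b ^+ 2)) exprMn ler_wpM2r ?sqr_ge0//.
by rewrite -natrX ler_nat expnS leq_pmulr.
Qed.

Lemma enorm_continuous : continuous (@enorm R n).
Proof.
have sq i : continuous (fun y : 'rV[R]_n => y ord0 i ^+ 2).
  by move=> y; apply: (@continuousM R); exact: coord_continuous.
have sum_sq : continuous (fun y : 'rV[R]_n => \sum_i y ord0 i ^+ 2).
  apply: (@continuous_big R _ (fun s t : R => s + t)); first exact: add_continuous.
  by move=> i _; exact: sq.
move=> x; apply: (@continuous_comp _ _ _ (fun y : 'rV[R]_n => \sum_i y ord0 i ^+ 2) Num.sqrt).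
  exact: sum_sq.
exact: sqrt_continuous.
Qed.

Lemma eball_open x (r : R) : open (eball x r).
Proof.
rewrite (_ : eball x r = (fun y => enorm (x - y)) @^-1` [set t | t < r])//.
apply: open_comp; last exact: (@open_lt R r).
move=> z _; apply: (@continuous_comp _ _ _ (fun y => x - y) (@enorm R n)).
  apply: (@continuousB _ 'rV[R]_n _ (fun=> x) id); first exact: cst_continuous.
  by [].
exact: enorm_continuous.
Qed.

End Enorm.

Section Content.
Variables (R : realType) (n : nat) (a : 'rV[R]_n) (L : R).
Hypothesis L0 : 0 < L.
Local Notation sd := (side L).
Local Notation crn := (corner a L).
Local Notation cc := (ccube a L).

Lemma hausdorff_content_ge0 (d : R) (E : set 'rV[R]_n) : (0 <= hausdorff_content d E)%E.
Proof.
apply: le_ereal_inf_tmp => _ [I [x [r [_ _ ->]]]].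
by apply: esum_ge0 => i _; rewrite lee_fin powR_ge0.
Qed.

Lemma hausdorff_content_mono (d : R) (E F : set 'rV[R]_n) : E `<=` F ->
  (hausdorff_content d E <= hausdorff_content d F)%E.
Proof.
move=> EF; apply: le_ereal_inf_tmp => s [I [x [r [r0 Fr ->]]]].
by apply: ereal_inf_lbound; exists I, x, r; split => //; exact: subset_trans EF Fr.
Qed.

Lemma ccube_eball Q : cc Q `<=` eball (crn Q) (n.+1%:R * sd Q.1).
Proof.
move=> x Qx; rewrite /eball /=; apply: le_lt_trans (enorm_le (b := sd Q.1) _) _.
  move=> i; have /andP[] := Qx i.
  have -> : (crn Q - x) ord0 i = crn Q ord0 i - x ord0 i by rewrite !mxE.
  by move: (crn Q ord0 i) => c lo hi; rewrite ler_norml; apply/andP; split; lra.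
by rewrite ltr_pM2r ?side_gt0// ltr_nat.
Qed.

(** A closed cube lies in an open ball of radius (n+1) side around its corner. *)
Lemma hausdorff_content_cubes (T : countType) (J : set T) (f : T -> cube n) (d : R)
    (E : set 'rV[R]_n) :
  (forall x, E x -> exists2 t, J t & cc (f t) x) ->
  (hausdorff_content d E <=
   \esum_(t in J) ((n.+1%:R * sd (f t).1) `^ d)%:E)%E.
Proof.
move=> EJ; apply: ereal_inf_lbound.
exists [set choice.pickle t | t in J].
exists (fun i => if @choice.unpickle T i is Some t then crn (f t) else 0).
exists (fun i => if @choice.unpickle T i is Some t then n.+1%:R * sd (f t).1 else 1).
split.
- by move=> _ [t _ <-]; rewrite choice.pickleK mulr_gt0// side_gt0.
- move=> x /EJ[t Jt tx]; exists (choice.pickle t); first by exists t.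
  by rewrite /= choice.pickleK; exact: ccube_eball.
- rewrite esum_image; first by apply: eq_esum => t _; rewrite choice.pickleK.
  by move=> s t _ _; apply: (pcan_inj choice.pickleK).
Qed.

(** Take the cubes of the generation with side comparable to r that meet the
    ball: their integer coordinates differ by at most 2 from those of a given one,
    so there are at most 5^n. A ball larger than the root is replaced by the
    root. *)
Lemma ball_strong_cover (delta : R) (y : 'rV[R]_n) (r : R) : 0 < delta -> 0 < r ->
  exists Bs, strong_cover a L (eball y r) Bs /\
    \sum_(B <- Bs) sd B.1 `^ delta <= 5%:R ^+ n * (2 * r) `^ delta.
Proof.
move=> delta0 r0.
have n5 : 1 <= 5%:R ^+ n :> R by rewrite exprn_ege1// ler1n.
have [Lr|rL] := leP L r.
  exists [:: topcube n]; split.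
    move=> x _; exists 0%N => Q Qtop _ _; exists (topcube n); split => //.
    by rewrite inE.
  rewrite big_seq1 /= /side expr0 divr1.
  apply: le_trans (_ : (2 * r) `^ delta <= _); last by rewrite ler_peMl// powR_ge0.
  by rewrite ge0_ler_powR ?nnegrE ?(ltW delta0) ?(ltW L0)//; lra.
have exj : exists j, sd j <= r.
  by have [j jP] := side_small L r0; exists j; exact/ltW/jP.
case: (ex_minnP exj) => -[|j]; first by rewrite /side expr0 divr1 leNgt rL.
move=> jr jmin; have rj : r < sd j.
  by rewrite ltNge; apply/negP => /jmin; rewrite ltnn.
have [[z0 [y0 [y0z y0r]]]|none] :=
  pselect (exists z0 y0, cc (j, z0) y0 /\ eball y r y0); last first.
  exists [::]; split; last by rewrite big_nil mulr_ge0 ?powR_ge0 ?exprn_ge0.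
  move=> x xr; exists j => Q _ jQ Qx; exfalso; apply: none.
  exists (anc j Q).2, x; split => //.
  exact: (ccube_sub L0 (subcube_anc jQ)).
(* Subtraction may truncate, but only for indices that are not used. *)
pose f (d : {ffun 'I_n -> 'I_5}) : cube n := (j, [ffun i => z0 i + d i - 2]%N).
exists [seq f d | d : {ffun 'I_n -> 'I_5}]; split; last first.
  rewrite big_image /= sumr_const card_ffun !card_ord -(mulr_natl (_ `^ _)) natrX.
  rewrite ler_wpM2l ?exprn_ge0// ge0_ler_powR ?nnegrE ?(ltW delta0) ?side_ge0//.
    by rewrite mulr_ge0// ltW.
  by rewrite sideS ler_wpM2l.
move=> x xr; exists j => Q _ jQ Qx; exists (anc j Q); split; last exact: subcube_anc.
have Qjx := ccube_sub L0 (subcube_anc jQ) Qx.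
set z := (anc j Q).2.
have zP i : (z0 i <= z i + 2)%N && (z i <= z0 i + 2)%N.
  have /andP[x1 x2] := Qjx i; have /andP[y1 y2] := y0z i.
  have xy : `|x ord0 i - y0 ord0 i| < 2 * sd j.
    have := le_lt_trans (coord_le_enorm _ i) xr; have := le_lt_trans (coord_le_enorm _ i) y0r.
    rewrite !mxE !ltr_norml => /andP[? ?] /andP[? ?]; apply/andP; split; lra.
  move: x1 x2 y1 y2; rewrite /corner !mxE -/z /= => x1 x2 y1 y2.
  move: xy; rewrite ltr_norml => /andP[xy1 xy2].
  have sj := side_gt0 L0 j.
  apply/andP; split.
    have : sd j * (z0 i)%:R < sd j * ((z i)%:R + 3) by lra.
    by rewrite ltr_pM2l// -natrD ltr_nat addnS ltnS.
  have : sd j * (z i)%:R < sd j * ((z0 i)%:R + 3) by lra.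
  by rewrite ltr_pM2l// -natrD ltr_nat addnS ltnS.
have zd i : (z i + 2 - z0 i < 5)%N by have := zP i; lia.
apply/fintype.imageP; exists [ffun i => Ordinal (zd i)] => //.
rewrite /f; congr pair; apply/ffunP => i; rewrite -[LHS]/(z i) [RHS]ffunE [in RHS]ffunE /=.
by have := zP i; lia.
Qed.

(** Balls are open, so by compactness finitely many of a nearly optimal covering
    suffice; each is then replaced by cubes. *)
Lemma strong_cover_exists (delta h : R) (E F : set 'rV[R]_n) : 0 < delta ->
  compact E -> E `<=` F -> (hausdorff_content delta F < h%:E)%E ->
  exists Bs, strong_cover a L E Bs /\
    \sum_(B <- Bs) sd B.1 `^ delta <= 5%:R ^+ n * 2 `^ delta * h.
Proof.
move=> delta0 cE EF /ereal_inf_lt[_ [I [y [r [r0 Fr ->]]]] Ih].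
have : cover_compact E by rewrite -compact_cover.
move=> /(_ nat I (fun i => eball (y i) (r i)))[|x Ex|D DI ED].
- by move=> i _; exact: eball_open.
- exact/Fr/EF.
have /choice[Cs CsP] : forall i, exists Bs, I i ->
    strong_cover a L (eball (y i) (r i)) Bs /\
    \sum_(B <- Bs) sd B.1 `^ delta <= 5%:R ^+ n * (2 * r i) `^ delta.
  move=> i; have [Ii|nIi] := pselect (I i); last by exists [::].
  by have [Bs BsP] := ball_strong_cover (y i) delta0 (r0 i Ii); exists Bs.
exists (flatten [seq Cs i | i <- enum_fset D]); split.
  move=> x /ED[i /= iD ix]; have [sc _] := CsP i (set_mem (DI _ iD)).
  have [j0 j0P] := sc x ix; exists j0 => Q Qtop jQ Qx.
  have [B [BC QB]] := j0P Q Qtop jQ Qx; exists B; split => //.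
  by apply/flattenP; exists (Cs i) => //; apply/mapP; exists i.
rewrite big_flatten big_map /=.
apply: le_trans (_ : \sum_(i <- enum_fset D) 5%:R ^+ n * (2 * r i) `^ delta <= _).
  rewrite big_seq [leRHS]big_seq; apply: ler_sum => i iD.
  by have [] := CsP i (set_mem (DI _ iD)).
apply: le_trans (_ : \sum_(i <- enum_fset D) (5%:R ^+ n * 2 `^ delta) * r i `^ delta <= _).
  rewrite big_seq [leRHS]big_seq; apply: ler_sum => i iD.
  by rewrite powRM ?mulrA// ltW// r0//; exact: (set_mem (DI _ iD)).
rewrite -mulr_sumr ler_wpM2l ?mulr_ge0 ?exprn_ge0 ?powR_ge0//.
rewrite -lee_fin -sumEFin; apply/ltW/(le_lt_trans _ Ih).
apply: esum_ge; exists [set` D].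
  by split; [exact: finite_fset|move=> i /= iD; exact: (set_mem (DI _ iD))].
by rewrite fsbig_finite ?finite_fset//= set_fsetK.
Qed.

End Content.

(** * Layer-cake inequalities *)

Section LayerCake.
Variable R : realType.
Variable F : R -> \bar R.
Hypothesis F_ge0 : forall t, (0 <= F t)%E.
Hypothesis F_nincr : forall s t, s <= t -> (F t <= F s)%E.
Local Notation mu := (@lebesgue_measure R).

(** Super-level sets of a monotone function are intervals. *)
Lemma nincr_emeasurable (D : set R) : measurable D -> measurable_fun D F.
Proof.
move=> mD _; apply: (measurability _ (ErealGenOInfty.measurableE R)) => // _ [_ [r ->] <-].
apply: measurableI => //; apply: is_interval_measurable => s t /= Fs Ft u /andP[su ut].
move: Ft; rewrite !in_itv /= !andbT => /lt_le_trans; apply; exact: F_nincr.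
Qed.

(** The right-hand side is the integral of the bound assumed for [F], integrated
    termwise after enumerating [T]. *)
Lemma layer_le_esum (T : countType) (J : set T) (c tau : T -> R) :
  (forall i, 0 <= c i) -> (forall i, 0 <= tau i) ->
  (forall t, 0 <= t ->
    (F t <= \esum_(i in [set i | J i /\ (t < tau i)%R]) (c i)%:E)%E) ->
  (\int[mu]_(t in `[0%R, +oo[) F t <= \esum_(i in J) (c i * tau i)%:E)%E.
Proof.
move=> c0 tau0 Fle.
pose e k : \bar R := if @choice.unpickle T k is Some i then
  (if (i \in J) && (choice.pickle i == k) then (c i)%:E else 0%E) else 0%E.
pose ta k : R := if @choice.unpickle T k is Some i then tau i else 0.
have e0 k : (0 <= e k)%E.
  by rewrite /e; case: choice.unpickle => // i; case: ifP => // _; rewrite lee_fin.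
have ta0 k : 0 <= ta k by rewrite /ta; case: choice.unpickle.
have toN (f : T -> R) (P : T -> bool) : (forall i, 0 <= f i) ->
    (\esum_(i in [set i | J i /\ P i]) (f i)%:E)%E =
    (\sum_(0 <= k <oo) (if @choice.unpickle T k is Some i then
      if [&& i \in J, P i & choice.pickle i == k] then (f i)%:E else 0 else 0))%E.
  move=> f0; set h := (X in (\sum_(0 <= k <oo) X k)%E).
  have h0 k : (0 <= h k)%E.
    by rewrite /h; case: choice.unpickle => // i; case: ifP => // _; rewrite lee_fin.
  rewrite nneseries_esumT//.
  rewrite (_ : \esum_(i in [set i | J i /\ P i]) (f i)%:E =
    \esum_(i in [set i | J i /\ P i]) h (choice.pickle i))%E; last first.
    apply: eq_esum => i [Ji Pi]; rewrite /h choice.pickleK Pi eqxx.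
    by rewrite mem_set.
  rewrite -(esum_image _ choice.pickle); last first.
    by move=> s t _ _; apply: (pcan_inj choice.pickleK).
  rewrite [LHS]esum_mkcond; apply: eq_esum => k _; case: ifPn => // kn.
  rewrite /h; case E : choice.unpickle => [i|//]; case: ifPn => // /and3P[iJ Pi /eqP ik].
  by move: kn; rewrite notin_setE => -[]; exists i => //; split => //; exact: set_mem.
pose h k t : \bar R := (e k * (\1_(`[0%R, ta k[ : set R) t)%:E)%E.
have mh k : measurable_fun (`[0%R, +oo[ : set R)
    (fun t => (\1_(`[0%R, ta k[ : set R) t)%:E : \bar R).
  by apply/measurable_EFinP/measurable_indic.
have h0 k t : (0 <= h k t)%E by rewrite mule_ge0// lee_fin.
have mhk k : measurable_fun (`[0%R, +oo[ : set R) (h k).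
  by apply: emeasurable_funM => //; exact: measurable_cst.
apply: le_trans (_ : \int[mu]_(t in `[0%R, +oo[) (\sum_(0 <= k <oo) h k t) <= _)%E.
  apply: ge0_le_integral => //.
  - exact: nincr_emeasurable.
  - apply: ge0_emeasurable_sum => // k _; exact: mhk.
  - move=> t; rewrite /= in_itv /= andbT => t0; apply: le_trans (Fle t t0) _.
    rewrite (toN c (fun i => (t < tau i)%R) c0); apply: lee_nneseries => k _.
      by case: choice.unpickle => // i; case: ifP => // _; rewrite lee_fin.
    rewrite /h /e /ta; case: choice.unpickle => [i|]; last by rewrite mul0e.
    case: ifPn => [/and3P[-> ti ->]|]; last first.
      by move=> _; rewrite mule_ge0//; case: ifP => // _; rewrite lee_fin.
    by rewrite /= indicE mem_set ?mule1//= in_itv /= t0 ti.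
rewrite integral_nneseries//.
rewrite (_ : J = [set i | J i /\ true]); last by apply/seteqP; split => i; [|case].
rewrite (toN (fun i => c i * tau i) (fun=> true)) => [|i]; last exact: mulr_ge0.
apply: lee_nneseries => k _; first by move=> _; apply: integral_ge0.
rewrite ge0_integralZl//; last exact: mh.
have -> : (\int[mu]_(t in `[0%R, +oo[) (\1_(`[0%R, ta k[ : set R) t)%:E =
    mu (`[0%R, ta k[ `&` `[0%R, +oo[))%E.
  by apply: integral_indic => //; exact: measurable_itv.
rewrite setIidl; last first.
  by move=> t /=; rewrite !in_itv /= andbT => /andP[].
rewrite /= lebesgue_measure_itv /= lte_fin /e /ta.
case: choice.unpickle => [i|]; last by rewrite mul0e.
case: ifPn => _; last by rewrite mul0e.
case: ifPn => [_|]; first by rewrite oppr0 adde0 -EFinM.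
by rewrite mule0 lee_fin mulr_ge0.
Qed.

(** On the interval from s (i+1) to s i the function is at least F (s i), and
    these intervals are disjoint. *)
Lemma sum_layers_le (s : nat -> R) K : (forall i, 0 <= s i) ->
  (forall i, s i.+1 <= s i) ->
  (\sum_(i < K) (s i - s i.+1)%:E * F (s i) <= \int[mu]_(t in `[0%R, +oo[) F t)%E.
Proof.
move=> s0 sS.
have mF D : measurable D -> measurable_fun D F by exact: nincr_emeasurable.
apply: le_trans (_ : \int[mu]_(t in `[s K, +oo[) F t <= _)%E; last first.
  apply: ge0_subset_integral => //; first exact: mF.
  by move=> t /=; rewrite !in_itv /= !andbT; exact: le_trans.
elim: K => [|K IH]; first by rewrite big_ord0 integral_ge0.
rewrite big_ord_recr /= addeC.
have -> : `[s K.+1, +oo[%classic = `[s K.+1, s K[ `|` `[s K, +oo[ :> set R.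
  by rewrite -itv_bndbnd_setU// bnd_simp.
rewrite ge0_integral_setU//=; last 2 first.
- by apply: mF; exact: measurableU.
- apply/disj_setPRL => t /=; rewrite !in_itv /= andbT => tK /andP[_].
  by rewrite ltNge tK.
apply: leeD => //.
apply: le_trans (_ : \int[mu]_(t in `[s K.+1, s K[) cst (F (s K)) t <= _)%E.
  rewrite integral_cst//= lebesgue_measure_itv /= lte_fin muleC.
  case: ifPn => [_|]; first by rewrite EFinB.
  by rewrite -leNgt => sK; rewrite (_ : s K - s K.+1 = 0) ?mule0//; have := sS K; lra.
apply: ge0_le_integral => //; [by move=> *; exact: F_ge0|exact: mF|].
by move=> t /=; rewrite in_itv /= => /andP[_ tK]; exact/F_nincr/ltW.
Qed.

End LayerCake.

(** * Choquet integrals of maximal functions *)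

Section Capacity.
Variables (R : realType) (n : nat) (a : 'rV[R]_n) (L : R).
Hypothesis L0 : 0 < L.
Variables (g : 'rV[R]_n -> R) (Lam : R).
Hypothesis g_ge0 : forall x, 0 <= g x.
Hypothesis g_lt : forall x, g x < Lam.
Hypothesis g_cont : continuous g.
Local Notation sd := (side L).
Local Notation cc := (ccube a L).
Local Notation M := (umean a L g).
Local Notation level := (level Lam).
Variable Bs : nat -> seq (cube n).
Hypothesis Bs_cover : forall i, strong_cover a L [set x | level i <= g x] (Bs i).
Variables delta p V : R.
Hypothesis delta_gt0 : 0 < delta.
Hypothesis delta_le : delta <= n%:R.
Hypothesis p_gt : delta / n%:R < p.
Hypothesis V_ge : forall K,
  \sum_(i < K) level i `^ p * cover_size L Bs delta i <= V.
Local Notation stopping := (stopping a L g Lam Bs).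
Local Notation cost := (cost L delta).

Definition stopping_const : R :=
  2 `^ (delta / n%:R) * 2 `^ p / (1 - level_ratio n delta p).

Local Notation Ks := stopping_const.

Lemma exponent_gt0 : 0 < p.
Proof.
apply: le_lt_trans p_gt; rewrite divr_ge0 ?(ltW delta_gt0)//.
Qed.

Lemma stopping_const_gt0 : 0 < Ks.
Proof.
have /andP[_ r1] := level_ratio_bnd p_gt.
by rewrite divr_gt0 ?mulr_gt0 ?powR_gt0// subr_gt0.
Qed.

Lemma umean_level Q : 0 < M Q -> exists k, level k < M Q /\ M Q <= 2 * level k.
Proof.
move=> MQ; have [j0 j0P] := side_small Lam MQ.
have ex : exists k, level k < M Q by exists j0; exact: j0P.
case: (ex_minnP ex) => -[|k] kM kmin.
  have := umean_le_bound a L0 g_ge0 g_lt Q.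
  by rewrite leNgt; move: kM; rewrite level0 => ->.
exists k.+1; split => //; rewrite -levelS leNgt; apply/negP => /kmin.
by rewrite ltnn.
Qed.

Lemma sum_stopping_le (S : seq (nat * cube n)) : uniq S ->
  (forall x, x \in S -> stopping x.1 x.2) ->
  \sum_(x <- S) level x.1 `^ p * sd x.2.1 `^ delta <= Ks * V.
Proof.
move=> uS Sstop; pose K := (\max_(x <- S) x.1).+1.
apply: le_trans (sum_level_cost g_ge0 g_lt p_gt K V_ge).
have SK x : x \in S -> (x.1 < K)%N.
  by move=> xS; rewrite ltnS; apply: (leq_bigmax_seq (F := fun x : nat * cube n => x.1)).
rewrite big_seq (eq_bigr (fun x => \sum_(k < K | k == x.1 :> nat)
  level k `^ p * sd x.2.1 `^ delta)); last first.
  by move=> x xS; rewrite (big_pred1 (Ordinal (SK x xS))).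
rewrite -big_seq (exchange_big_dep predT)//=; apply: ler_sum => k _.
rewrite -mulr_sumr ler_wpM2l ?powR_ge0//.
apply: le_trans (stopping_sum (X := [seq x.2 | x <- S & k == x.1 :> nat])
  L0 g_ge0 g_lt g_cont Bs_cover delta_gt0 delta_le _ _).
- by rewrite big_map big_filter.
- rewrite map_inj_in_uniq ?filter_uniq// => -[i B] [j D].
  by rewrite !mem_filter /= => /andP[/eqP <- _] /andP[/eqP <- _] ->.
- move=> D /mapP[[i B]]; rewrite mem_filter /= => /andP[/eqP ki iB] ->.
  by rewrite ki; exact: (Sstop (i, B)).
Qed.

(** The stopping cube above [Q] alone contributes this much to the sum of
    [sum_stopping_le]. *)
Lemma umean_size Q : subcube Q (topcube n) ->
  M Q `^ p * sd Q.1 `^ delta <= 2 `^ p * Ks * V.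
Proof.
move=> Qtop; have p0 := exponent_gt0.
have V0 : 0 <= V by have := V_ge 0; rewrite big_ord0.
have [->|MQ0] := eqVneq (M Q) 0.
  rewrite powR0 ?gt_eqF// mul0r; apply: mulr_ge0 => //; apply: mulr_ge0.
    exact: powR_ge0.
  exact/ltW/stopping_const_gt0.
have MQ : 0 < M Q by rewrite lt0r MQ0 (umean_ge0 a L0 g_ge0 g_lt).
have [k [kM Mk]] := umean_level MQ.
have [D kD QD] := stopping_cover Bs Qtop kM.
have := @sum_stopping_le [:: (k, D)] isT _; rewrite big_seq1 /= => H.
rewrite -mulrA; apply: le_trans (ler_wpM2l (powR_ge0 2 p) (H _)); last first.
  by move=> x; rewrite inE => /eqP ->.
have lk := level_gt0 g_ge0 g_lt k.
rewrite mulrA -powRM ?(ltW lk)//; apply: ler_pM; rewrite ?powR_ge0//.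
  by rewrite ge0_ler_powR ?nnegrE ?(ltW p0) ?(ltW MQ)// mulr_ge0// ltW.
rewrite ge0_ler_powR ?nnegrE ?(ltW delta_gt0) ?side_ge0//.
by apply: side_le => //; exact: subcube_level.
Qed.

(** If the mean of [g] over [Q] is between level k and 2 (level k), then [Q] lies
    in a stopping cube D of level [k], and side(D) >= side(Q). So the stopping
    cubes D with t < C0 side(D)^(kappa p) (2 level k)^p cover {f > t}.
    Integrating in t the sum of side(D)^(delta - kappa p) over these cubes gives
    the sum of (level k)^p side(D)^delta over all stopping cubes. *)
Lemma choquet_le (kappa C0 : R) (Omega : set 'rV[R]_n) (f : 'rV[R]_n -> \bar R) :
  0 <= kappa -> 0 <= C0 ->
  (forall x t, 0 <= t -> Omega x -> (t%:E < f x)%E -> exists Q,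
     [/\ subcube Q (topcube n), cc Q x & t < C0 * (sd Q.1 `^ (kappa * p) * M Q `^ p)]) ->
  (choquet_integral (delta - kappa * p) Omega f <=
   (n.+1%:R `^ (delta - kappa * p) * 2 `^ p * Ks * (C0 * V))%:E)%E.
Proof.
move=> kappa0 C00 fP; have p0 := exponent_gt0.
set d := delta - kappa * p.
pose J : set (nat * cube n) := [set x | stopping x.1 x.2].
pose c (x : nat * cube n) := (n.+1%:R * sd x.2.1) `^ d.
pose tau (x : nat * cube n) := C0 * (sd x.2.1 `^ (kappa * p) * (2 * level x.1) `^ p).
pose F t := hausdorff_content d [set x | Omega x /\ (t%:E < f x)%E].
apply: le_trans (_ : \esum_(x in J) (c x * tau x)%:E <= _)%E.
  apply: (@layer_le_esum _ F).
  - by move=> t; exact: hausdorff_content_ge0.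
  - move=> s t st; apply: hausdorff_content_mono => x [Ox tf]; split => //.
    by apply: le_lt_trans tf; rewrite lee_fin.
  - by move=> i; exact: powR_ge0.
  - by move=> i; rewrite !mulr_ge0 ?powR_ge0.
  - move=> t t0; apply: hausdorff_content_cubes => // x [Ox tf].
    have [Q [Qtop Qx tQ]] := fP x t t0 Ox tf.
    have MQ : 0 < M Q.
      rewrite lt0r (umean_ge0 a L0 g_ge0 g_lt) andbT; apply/eqP => M0.
      by move: tQ; rewrite M0 powR0 ?gt_eqF// !mulr0 ltNge t0.
    have [k [kM Mk]] := umean_level MQ.
    have [D kD QD] := stopping_cover Bs Qtop kM.
    exists (k, D) => /=; last exact: (ccube_sub L0 QD).
    split => //=; apply: lt_le_trans tQ _; rewrite ler_wpM2l//.
    have lk := level_gt0 g_ge0 g_lt k.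
    apply: ler_pM; rewrite ?powR_ge0//.
      rewrite ge0_ler_powR ?nnegrE ?side_ge0 ?mulr_ge0 ?(ltW p0)//.
      by apply: side_le => //; exact: subcube_level.
    by rewrite ge0_ler_powR ?nnegrE ?(ltW p0) ?(ltW MQ)// mulr_ge0// ltW.
have ctau x : c x * tau x =
    n.+1%:R `^ d * 2 `^ p * C0 * (level x.1 `^ p * sd x.2.1 `^ delta).
  have sx := side_gt0 L0 x.2.1; have lx := level_gt0 g_ge0 g_lt x.1.
  rewrite /c /tau (powRM _ _ (ltW sx))// (powRM _ _ (ltW lx))//.
  have -> : sd x.2.1 `^ delta = sd x.2.1 `^ d * sd x.2.1 `^ (kappa * p).
    rewrite -powRD; last by rewrite (gt_eqF sx) implybT.
    by rewrite /d subrK.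
  by ring.
apply: ge_ereal_sup => _ [X [finX XJ] <-].
rewrite fsbig_finite//= sumEFin lee_fin.
under eq_bigr do rewrite ctau.
have -> : n.+1%:R `^ d * 2 `^ p * Ks * (C0 * V) =
    n.+1%:R `^ d * 2 `^ p * C0 * (Ks * V) by move: Ks => K; ring.
rewrite -mulr_sumr ler_wpM2l ?mulr_ge0 ?powR_ge0//.
apply: sum_stopping_le; first exact: fset_uniq.
by move=> x; rewrite in_fset_set// => /set_mem/XJ.
Qed.

End Capacity.

(** * Poincare and Sobolev inequalities from covers of the level sets *)

Definition geom_const (R : realType) (al : R) : R := (1 - 2 `^ (- al))^-1.

Section Geometric.
Variables (R : realType) (L : R).
Hypothesis L0 : 0 < L.
Local Notation sd := (side L).

Lemma sum_side m : \sum_(j < m) sd j <= 2 * L.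
Proof.
suff -> : \sum_(j < m) sd j = 2 * L - 2 * sd m by have := side_gt0 L0 m; lra.
elim: m => [|m IH]; first by rewrite big_ord0 /side expr0 divr1 subrr.
by rewrite big_ord_recr /= IH (sideS L m); ring.
Qed.

Variable al : R.
Hypothesis al0 : 0 < al.

Lemma half_powR_lt1 : (2 : R) `^ (- al) < 1.
Proof.
have: (2 : R) `^ (- al) <= 2 `^ 0 by rewrite ler_powR ?ler1n// oppr_le0 ltW.
rewrite powRr0 lt_neqAle => ->; rewrite powR_eq1 andbT oppr_eq0 (gt_eqF al0).
by rewrite orbF negb_or gt_eqF ?ltr1n//= -leNgt ler0n.
Qed.

Lemma geom_const_gt0 : 0 < geom_const al.
Proof. by rewrite invr_gt0 subr_gt0 half_powR_lt1. Qed.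

Lemma geom_constE : geom_const al = 1 + geom_const al * 2 `^ (- al).
Proof.
have h : 1 - (2 : R) `^ (- al) != 0 by rewrite subr_eq0 gt_eqF ?half_powR_lt1.
by rewrite /geom_const; field.
Qed.

(** The tail of the geometric series is added on the left to make the induction
    work; [Num.min r (side L m)] is the largest side that can still occur. *)
Lemma sum_small_sides (r : R) m : 0 < r ->
  \sum_(j < m | sd j <= r) sd j `^ al <= geom_const al * r `^ al.
Proof.
move=> r0; have c0 := geom_const_gt0.
suff: \sum_(j < m | sd j <= r) sd j `^ al + geom_const al * (Num.min r (sd m)) `^ al <=
    geom_const al * r `^ al.
  by apply: le_trans; rewrite lerDl mulr_ge0 ?powR_ge0// ltW.
have mono (x y : R) : 0 <= x -> x <= y -> geom_const al * x `^ al <= geom_const al * y `^ al.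
  move=> x0 xy; rewrite ler_pM2l// ge0_ler_powR ?nnegrE ?(ltW al0)//.
  exact: le_trans xy.
elim: m => [|m IH].
  rewrite big_ord0 add0r; apply: mono; last by rewrite ge_min lexx.
  by rewrite le_min (ltW r0) side_ge0.
have sm := side_gt0 L0 m; have sm1 := side_gt0 L0 m.+1.
rewrite big_mkcond big_ord_recr -big_mkcond /=; case: (leP (sd m) r) => mr.
  apply: le_trans IH; rewrite (min_idPr mr) -addrA lerD2l.
  have /min_idPr -> : sd m.+1 <= r by apply: le_trans mr; exact: side_le.
  have -> : sd m `^ al = 2 `^ al * sd m.+1 `^ al by rewrite sideS powRM ?(ltW sm1).
  have tp : (2 : R) `^ al * 2 `^ (- al) = 1 by rewrite powRN mulfV// gt_eqF ?powR_gt0.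
  move: geom_constE tp; set c := geom_const al; set s := sd m.+1 `^ al.
  set A := 2 `^ al; set B := 2 `^ (- al) => cE AB.
  have -> : c * (A * s) = (1 + c * B) * (A * s) by rewrite -cE.
  have -> : (1 + c * B) * (A * s) = A * s + c * (A * B) * s by ring.
  by rewrite AB mulr1.
rewrite addr0; apply: le_trans IH; rewrite lerD2l (min_idPl (ltW mr)).
by apply: mono; [rewrite le_min (ltW r0) (ltW sm1)|rewrite ge_min lexx].
Qed.

(** Same induction as for [sum_small_sides], where now the smallest side counts. *)
Lemma sum_large_sides (r : R) m : 0 < r ->
  \sum_(j < m | r < sd j) sd j `^ (- al) <= geom_const al * r `^ (- al).
Proof.
move=> r0; have c0 := geom_const_gt0.
have mono (x y : R) : 0 < x -> x <= y ->
    geom_const al * y `^ (- al) <= geom_const al * x `^ (- al).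
  move=> x0 xy; have y0 := lt_le_trans x0 xy.
  rewrite ler_pM2l// !powRN lef_pV2 ?posrE ?powR_gt0//.
  by rewrite ge0_ler_powR ?nnegrE ?(ltW al0) ?(ltW x0) ?(ltW y0).
suff: \sum_(j < m | r < sd j) sd j `^ (- al) <=
    geom_const al * (Num.max r (2 * sd m)) `^ (- al).
  by move/le_trans; apply; apply: mono => //; rewrite le_max lexx.
elim: m => [|m IH]; first by rewrite big_ord0 mulr_ge0 ?powR_ge0// ltW.
have sm := side_gt0 L0 m.
rewrite big_mkcond big_ord_recr -big_mkcond /= -sideS; case: (ltP r (sd m)) => mr.
  have m2 : r <= 2 * sd m by lra.
  move: IH; rewrite (max_idPr m2) => IH.
  rewrite {1}geom_constE mulrDl mul1r addrC lerD2l; apply: le_trans IH _.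
  by rewrite (powRM _ _ (ltW sm))// mulrA.
rewrite addr0; apply: le_trans IH _; apply: mono => //.
by rewrite le_max lexx.
Qed.

End Geometric.

(** The first bound is used for sides at most [r], the second for larger sides. *)
Lemma hedberg_sum (R : realType) (L al be r sigma D : R) (y : nat -> R) m :
  0 < L -> 0 < al -> 0 < be -> 0 < r -> 0 <= sigma -> 0 <= D ->
  (forall j, y j <= sigma * side L j `^ al) ->
  (forall j, y j <= D * side L j `^ (- be)) ->
  \sum_(j < m) y j <=
    sigma * (geom_const al * r `^ al) + D * (geom_const be * r `^ (- be)).
Proof.
move=> L0 al0 be0 r0 s0 D0 y1 y2; rewrite (bigID (fun j : 'I_m => side L j <= r)) /=.
apply: lerD.
  apply: le_trans (ler_wpM2l s0 (sum_small_sides L0 al0 m r0)).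
  by rewrite mulr_sumr; apply: ler_sum => j _.
apply: le_trans (ler_wpM2l D0 (sum_large_sides L0 be0 m r0)).
rewrite mulr_sumr (eq_bigl (fun j : 'I_m => r < side L j)); last by move=> j; rewrite ltNge.
by apply: ler_sum => j _.
Qed.

Lemma powR_div (R : realType) (x y p : R) : 0 <= x -> 0 < y ->
  (x / y) `^ p = x `^ p / y `^ p.
Proof.
move=> x0 y0; rewrite powRM ?invr_ge0 ?(ltW y0)//; congr (_ * _).
by rewrite -powR_inv1 ?(ltW y0)// -powRrM mulN1r powRN.
Qed.

Section Sobolev.
Variables (R : realType) (n : nat) (a : 'rV[R]_n) (L : R).
Hypothesis L0 : 0 < L.
Variables (g : 'rV[R]_n -> R) (Lam : R).
Hypothesis g_ge0 : forall x, 0 <= g x.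
Hypothesis g_lt : forall x, g x < Lam.
Hypothesis g_cont : continuous g.
Variable u : 'rV[R]_n -> R.
Hypothesis u_cont : continuous u.
Hypothesis u_lip : forall x (i : 'I_n) (h c : R), 0 <= h ->
  (forall t, 0 <= t <= h -> g (x + t *: delta_mx ord0 i) <= c) ->
  `|u (x + h *: delta_mx ord0 i) - u x| <= h * c.
Hypothesis u_supp : forall x, u x != 0 -> forall i,
  a ord0 i <= x ord0 i < a ord0 i + side L 1.
Variable Bs : nat -> seq (cube n).
Hypothesis Bs_cover :
  forall i, strong_cover a L [set x | level Lam i <= g x] (Bs i).
Variables delta p V : R.
Hypothesis delta_gt0 : 0 < delta.
Hypothesis delta_le : delta <= n%:R.
Hypothesis p_gt : delta / n%:R < p.
Hypothesis V_ge : forall K,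
  \sum_(i < K) level Lam i `^ p * cover_size L Bs delta i <= V.
Local Notation sd := (side L).
Local Notation M := (umean a L g).
Local Notation Ks := (stopping_const n delta p).
Local Notation Cn := (n%:R * 2 ^+ n : R).
Local Notation xc := (cube_at a L).

Let n_gt0 : (0 < n)%N.
Proof. by rewrite -(ltr0n R); exact: lt_le_trans delta_gt0 delta_le. Qed.

Let Cn_gt0 : 0 < Cn. Proof. by rewrite mulr_gt0 ?ltr0n ?exprn_gt0. Qed.

Let p_gt0 : 0 < p. Proof. exact: exponent_gt0 delta_gt0 p_gt. Qed.

Lemma support_in_topcube x : u x != 0 -> ccube a L (topcube n) x.
Proof.
move=> ux i; have /andP[lo hi] := u_supp ux i.
rewrite !mxE /= ffunE mulr0 addr0 lo /= (ltW (lt_le_trans hi _))// lerD2l.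
exact: side_le.
Qed.

Definition poincare_const : R :=
  n.+1%:R `^ delta * 2 `^ p * Ks * (8 * Cn) `^ p.

Lemma poincare_const_gt0 : 0 < poincare_const.
Proof.
apply: mulr_gt0; last by apply: powR_gt0; exact: mulr_gt0.
by apply: mulr_gt0; [apply: mulr_gt0; exact: powR_gt0|exact: (stopping_const_gt0 p_gt)].
Qed.

(** The sides of the cubes containing [x] sum to at most [2 * L], so one of the
    means in [pointwise_bound] exceeds |u(x)| / (8 Cn L). *)
Lemma poincare_bound (Omega : set 'rV[R]_n) :
  (choquet_integral delta Omega (fun x => (`|u x| `^ p)%:E) <=
   (poincare_const * L `^ p * V)%:E)%E.
Proof.
have C00 : 0 <= (8 * Cn * L) `^ p by exact: powR_ge0.
have := @choquet_le _ _ _ _ L0 _ _ g_ge0 g_lt g_cont _ Bs_cover _ _ _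
  delta_gt0 delta_le p_gt V_ge 0 ((8 * Cn * L) `^ p) Omega
  (fun x => (`|u x| `^ p)%:E) (lexx _) C00.
have C80 : 0 < 8 * Cn by rewrite mulr_gt0.
have C1 : 0 < 8 * Cn * L by rewrite mulr_gt0.
have cE : (8 * Cn * L) `^ p = (8 * Cn) `^ p * L `^ p.
  by rewrite powRM ?(ltW C80) ?(ltW L0).
rewrite mul0r subr0 => /(_ _)/le_trans; apply; last first.
  rewrite lee_fin cE /poincare_const le_eqVlt; apply/orP; left; apply/eqP.
  by move: Ks => K; ring.
move=> x t t0 Ox; rewrite lte_fin => tu.
have ux : u x != 0.
  apply/eqP => u0; move: tu; rewrite u0 normr0 powR0 ?gt_eqF//.
  by rewrite ltNge t0.
have [j Hj] : exists j, `|u x| < 8 * Cn * L * M (xc x j).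
  apply: contrapT => none.
  have le j : M (xc x j) <= `|u x| / (8 * Cn * L).
    rewrite ler_pdivlMr// mulrC leNgt; apply/negP => lt.
    by apply: none; exists j.
  have w0 : 0 < `|u x| by rewrite normr_gt0.
  have [m] := pointwise_bound L0 g_ge0 g_lt u_cont u_lip n_gt0 u_supp ux
    (divr_gt0 w0 (ltr0n R 2)).
  apply/negP; rewrite -ltNge.
  have : Cn * \sum_(j < m) sd j * M (xc x j) <= Cn * (2 * L * (`|u x| / (8 * Cn * L))).
    rewrite ler_pM2l ?Cn_gt0//.
    apply: le_trans (_ : \sum_(j < m) sd j * (`|u x| / (8 * Cn * L)) <= _).
      by apply: ler_sum => j _; rewrite ler_wpM2l ?side_ge0.
    rewrite -mulr_suml ler_wpM2r ?sum_side// divr_ge0 ?(ltW w0)//.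
    by rewrite !mulr_ge0 ?(ltW L0) ?(ltW Cn_gt0).
  have -> : Cn * (2 * L * (`|u x| / (8 * Cn * L))) = `|u x| / 4.
    by field; rewrite gt_eqF//= !gt_eqF ?exprn_gt0 ?ltr0n.
  by lra.
exists (xc x j); split; [exact: cube_at_top|exact/cube_at_in/support_in_topcube|].
have M0 : 0 <= M (xc x j) by exact: (umean_ge0 a L0 g_ge0 g_lt).
rewrite powRr0 mul1r -powRM ?(ltW C1)//.
apply: lt_le_trans tu _; rewrite ge0_ler_powR ?nnegrE ?(ltW p_gt0) ?(ltW Hj)//.
by rewrite mulr_ge0 ?(ltW C1).
Qed.

Variable kappa : R.
Hypothesis kappa_ge0 : 0 <= kappa.
Hypothesis kappa_lt1 : kappa < 1.
Hypothesis p_lt : p < delta.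
Hypothesis V_gt0 : 0 < V.
Local Notation al := (1 - kappa).
Local Notation be := (delta / p - 1).
Local Notation q := (p * (delta - kappa * p) / (delta - p)).
Local Notation K3 := (2 `^ p * Ks).

Let al_gt0 : 0 < al. Proof. by rewrite subr_gt0. Qed.

Let be_gt0 : 0 < be. Proof. by rewrite subr_gt0 ltr_pdivlMr ?mul1r. Qed.

Let K3_gt0 : 0 < K3.
Proof. by rewrite mulr_gt0 ?powR_gt0// (stopping_const_gt0 p_gt). Qed.

Definition hedberg_const : R :=
  (4 * Cn * geom_const al) `^ p * (8 * Cn * geom_const be) `^ (al * p / be).

Definition sobolev_const : R :=
  n.+1%:R `^ (delta - kappa * p) * 2 `^ p * Ks *
  (hedberg_const * K3 `^ (al / be)).

Lemma sobolev_const_gt0 : 0 < sobolev_const.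
Proof.
have ca0 := geom_const_gt0 al_gt0; have cb0 := geom_const_gt0 be_gt0.
have h0 : 0 < hedberg_const.
  by apply: mulr_gt0; apply: powR_gt0; apply: mulr_gt0 => //; exact: mulr_gt0.
apply: mulr_gt0; last by apply: mulr_gt0 => //; exact: powR_gt0.
apply: mulr_gt0; last exact: (stopping_const_gt0 p_gt).
by apply: mulr_gt0; exact: powR_gt0.
Qed.

(** With V a bound for the integral of g^p, [umean_size] gives
    mean(Q) <= D side(Q)^(-delta/p), D^p = K3 V. Suppose that side^kappa times the
    mean is at most [sigma] for all cubes containing [x]. In [hedberg_sum] take the
    scale [r] at which the large cubes contribute |u(x)| / 8. If
    sigma^p < |u(x)|^q / C0, the small ones contribute less than |u(x)| / 4, which
    contradicts [pointwise_bound]. The powers of |u(x)| match because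
    q = p + (1 - kappa) p / be with be = delta/p - 1. *)
Lemma sobolev_bound (Omega : set 'rV[R]_n) :
  (choquet_integral (delta - kappa * p) Omega (fun x => (`|u x| `^ q)%:E) <=
   (sobolev_const * V `^ ((delta - kappa * p) / (delta - p)))%:E)%E.
Proof.
have absorb (c s v : R) : 0 < v -> s < v -> c <= s / 4 + v / 8 -> v / 2 + c < v.
  by move=> *; lra.
have ca0 := geom_const_gt0 al_gt0; have cb0 := geom_const_gt0 be_gt0.
have dp0 : 0 < delta - p by rewrite subr_gt0.
have d0 : 0 < delta - kappa * p by have := al_gt0; have := p_gt0; nra.
have q0 : 0 < q by rewrite divr_gt0 ?mulr_gt0.
have KV : 0 < K3 * V by rewrite mulr_gt0.
pose D := (K3 * V) `^ p^-1.
have D0 : 0 < D by rewrite powR_gt0.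
have Dp : D `^ p = K3 * V.
  by rewrite -powRrM mulVf ?gt_eqF// powRr1// ltW.
have A0 : 0 < 4 * Cn * geom_const al by rewrite mulr_gt0// mulr_gt0.
have B0 : 0 < 8 * Cn * geom_const be by rewrite mulr_gt0// mulr_gt0.
pose C0 := (4 * Cn * geom_const al) `^ p * (8 * Cn * geom_const be * D) `^ (al * p / be).
have BD : 0 < 8 * Cn * geom_const be * D by exact: mulr_gt0.
have C0_gt0 : 0 < C0 by apply: mulr_gt0; exact: powR_gt0.
have DE : D `^ (al * p / be) = K3 `^ (al / be) * V `^ (al / be).
  rewrite -(powRM _ (ltW K3_gt0) (ltW V_gt0)) -Dp -powRrM; congr (_ `^ _); ring.
have C0E : C0 = hedberg_const * K3 `^ (al / be) * V `^ (al / be).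
  by rewrite /C0 /hedberg_const (powRM _ (ltW B0) (ltW D0)) DE !mulrA.
have := @choquet_le _ _ _ _ L0 _ _ g_ge0 g_lt g_cont _ Bs_cover _ _ _
  delta_gt0 delta_le p_gt V_ge kappa C0 Omega
  (fun x => (`|u x| `^ q)%:E) kappa_ge0 (ltW C0_gt0).
move=> /(_ _)/le_trans; apply; last first.
  rewrite lee_fin C0E /sobolev_const le_eqVlt; apply/orP; left; apply/eqP.
  have -> : V `^ ((delta - kappa * p) / (delta - p)) = V `^ (al / be) * V.
    rewrite -{3}(powRr1 (ltW V_gt0)) -powRD; last by rewrite (gt_eqF V_gt0) implybT.
    by congr (_ `^ _); field; rewrite !gt_eqF//; lra.
  by ring.
move=> x t t0 Ox; rewrite lte_fin => tu.
have ux : u x != 0.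
  apply/eqP => u0; move: tu; rewrite u0 normr0 powR0 ?gt_eqF//.
  by rewrite ltNge t0.
apply: contrapT => none.
have Mle j : C0 * (sd j `^ (kappa * p) * M (xc x j) `^ p) <= t.
  rewrite leNgt; apply/negP => lt; apply: none; exists (xc x j).
  by split; [exact: cube_at_top|exact/cube_at_in/support_in_topcube|rewrite cube_at_level].
have M0 j : 0 <= M (xc x j) by exact: (umean_ge0 a L0 g_ge0 g_lt).
pose w := `|u x|; have w0 : 0 < w by rewrite normr_gt0.
pose sigma := (t / C0) `^ p^-1.
have sigma0 : 0 <= sigma by exact: powR_ge0.
have tC : 0 <= t / C0 by rewrite divr_ge0// ltW.
have pi0 : 0 < p^-1 by rewrite invr_gt0.
have rootp (z y : R) : 0 <= z -> z `^ p <= y -> z <= y `^ p^-1.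
  move=> z0 zy; rewrite -(powRr1 z0) -(mulfV (lt0r_neq0 p_gt0)) powRrM.
  by rewrite ge0_ler_powR ?nnegrE ?(ltW pi0) ?powR_ge0// (le_trans _ zy) ?powR_ge0.
have y1 j : sd j * M (xc x j) <= sigma * sd j `^ al.
  have sj := side_gt0 L0 j.
  have e : sd j `^ kappa * sd j `^ al = sd j.
    rewrite -powRD; last by rewrite (gt_eqF sj) implybT.
    by rewrite addrC subrK powRr1 // ltW.
  rewrite -{1}e mulrAC.
  rewrite ler_wpM2r ?powR_ge0//; apply: rootp; first by rewrite mulr_ge0 ?powR_ge0.
  rewrite powRM ?powR_ge0// -powRrM ler_pdivlMr// mulrC; exact: Mle.
have y2 j : sd j * M (xc x j) <= D * sd j `^ (- be).
  have sj := side_gt0 L0 j.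
  have sd0 : 0 < sd j `^ (delta / p) by rewrite powR_gt0.
  have : M (xc x j) * sd j `^ (delta / p) <= D.
    apply: rootp; first by rewrite mulr_ge0// ltW.
    rewrite powRM ?(ltW sd0)// -powRrM divfK ?gt_eqF//.
    have := umean_size L0 g_ge0 g_lt g_cont Bs_cover
      delta_gt0 delta_le p_gt V_ge (cube_at_top a L x j).
    by rewrite cube_at_level.
  rewrite -ler_pdivlMr// => H.
  apply: le_trans (ler_wpM2l (ltW sj) H) _.
  rewrite le_eqVlt; apply/orP; left; apply/eqP.
  rewrite mulrCA; congr (_ * _).
  rewrite opprB powRB; last by rewrite (gt_eqF sj) implybT.
  by rewrite powRr1 // ltW.
(* The scale at which the large cubes contribute [w / 8]. *)
pose z := 8 * Cn * geom_const be * D / w.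
have z0 : 0 < z by exact: divr_gt0.
pose r := z `^ be^-1.
have r0 : 0 < r by rewrite powR_gt0.
have rbe : r `^ (- be) = z^-1.
  by rewrite powRN -powRrM mulVf ?gt_eqF// powRr1// ltW.
have [m] := pointwise_bound L0 g_ge0 g_lt u_cont u_lip n_gt0 u_supp ux
  (divr_gt0 w0 (ltr0n R 2)).
apply/negP; rewrite -ltNge -/w.
have := hedberg_sum m L0 al_gt0 be_gt0 r0 sigma0 (ltW D0) y1 y2.
rewrite rbe; set S := \sum_(j < m) _ => SH.
pose A := 4 * Cn * geom_const al; pose X := A * r `^ al.
have X0 : 0 < X by rewrite mulr_gt0 ?powR_gt0.
have sig : sigma * X < w.
  rewrite -ltr_pdivlMr//.
  have wX : 0 <= w / X by rewrite divr_ge0 ?(ltW w0) ?(ltW X0).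
  have sp : sigma `^ p = t / C0.
    by rewrite /sigma -powRrM mulVf ?(gt_eqF p_gt0)// powRr1.
  rewrite ltNge; apply/negP => wsig.
  have : (w / X) `^ p <= sigma `^ p by rewrite ge0_ler_powR ?nnegrE ?(ltW p_gt0).
  apply/negP; rewrite -ltNge sp.
  rewrite ltr_pdivrMr// (lt_le_trans tu)// -/w le_eqVlt; apply/orP; left; apply/eqP.
  rewrite powR_div ?(ltW w0)// /X (powRM _ (ltW A0) (powR_ge0 _ _)) /C0 -/A -powRrM.
  pose e := al * p / be.
  have -> : r `^ (al * p) = (8 * Cn * geom_const be * D) `^ e / w `^ e.
    by rewrite -powR_div ?(ltW BD)// /r -powRrM; congr (_ `^ _); rewrite /e; ring.
  have -> : w `^ q = w `^ p * w `^ e.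
    rewrite -powRD; last by rewrite (gt_eqF w0) implybT.
    rewrite (_ : p + e = q)//; rewrite /e.
    by field; rewrite !gt_eqF//; lra.
  have Ap : A `^ p != 0 by rewrite gt_eqF ?powR_gt0.
  have Be : (8 * Cn * geom_const be * D) `^ e != 0 by rewrite gt_eqF ?powR_gt0.
  have we : w `^ e != 0 by rewrite gt_eqF ?powR_gt0.
  by rewrite -/e; field; rewrite Ap Be we.
have SC := ler_wpM2l (ltW Cn_gt0) SH.
have E1 : Cn * (sigma * (geom_const al * r `^ al)) = sigma * X / 4 by rewrite /X /A; field.
have E2 : Cn * (D * (geom_const be / z)) = w / 8.
  by rewrite /z; field; rewrite !gt_eqF ?exprn_gt0 ?ltr0n.
have {}SC : Cn * S <= sigma * X / 4 + w / 8 by rewrite -E1 -E2 -mulrDr.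
exact: (absorb _ _ _ w0 sig SC).
Qed.

End Sobolev.

(** * Covers of the level sets *)

Section LevelCovers.
Variables (R : realType) (n : nat) (a : 'rV[R]_n) (L : R).
Hypothesis L0 : 0 < L.
Variables (g : 'rV[R]_n -> R) (Lam : R).
Hypothesis g_ge0 : forall x, 0 <= g x.
Hypothesis g_lt : forall x, g x < Lam.
Local Notation level := (level Lam).
Hypothesis g_compact : forall i, compact [set x | level i <= g x].
Variable Omega : set 'rV[R]_n.
Hypothesis g_supp : forall x, g x != 0 -> Omega x.
Variables delta p V : R.
Hypothesis delta_gt0 : 0 < delta.
Hypothesis p_gt0 : 0 < p.
Hypothesis V_gt0 : 0 < V.
Hypothesis V_ge :
  (choquet_integral delta Omega (fun x => (g x `^ p)%:E) <= V%:E)%E.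

(** The measure of the interval from (level (i+2))^p to (level (i+1))^p, divided by
    (level i)^p. *)
Definition layer_const : R := 2 `^ (- p) * (1 - 2 `^ (- p)).

Definition cover_const : R :=
  5%:R ^+ n * 2 `^ delta * (layer_const^-1 + 1).

Lemma layer_const_gt0 : 0 < layer_const.
Proof. by rewrite mulr_gt0 ?powR_gt0// subr_gt0 half_powR_lt1. Qed.

Lemma cover_const_gt0 : 0 < cover_const.
Proof.
apply: mulr_gt0; first by rewrite mulr_gt0 ?exprn_gt0 ?powR_gt0.
by rewrite ltr_wpDl// invr_ge0 ltW ?layer_const_gt0.
Qed.

(** The covers of {g >= level i} are taken nearly optimal for the content of the
    larger set {g > level (i+1)}, so that compactness applies. Their defects
    [eta] are summable with total at most [V]; being positive, they also take care
    of level sets of content 0. *)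
Lemma level_covers : exists Bs,
  (forall i, strong_cover a L [set x | level i <= g x] (Bs i)) /\
  (forall K, \sum_(i < K) level i `^ p * cover_size L Bs delta i <= cover_const * V).
Proof.
have l0 := level_gt0 g_ge0 g_lt.
pose F t := hausdorff_content delta [set x | Omega x /\ (t%:E < (g x `^ p)%:E)%E].
have F0 t : (0 <= F t)%E by exact: hausdorff_content_ge0.
have Fm s t : s <= t -> (F t <= F s)%E.
  move=> st; apply: hausdorff_content_mono => x [Ox tg]; split => //.
  by apply: le_lt_trans tg; rewrite lee_fin.
pose s i := level i.+1 `^ p.
have sE i : s i = level i `^ p * 2 `^ (- p).
  have -> : level i = 2 * level i.+1 by exact: levelS.
  have tp : (2 : R) `^ p * 2 `^ (- p) = 1 by rewrite powRN mulfV// gt_eqF ?powR_gt0.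
  by rewrite (powRM _ _ (ltW (l0 _)))// mulrAC tp mul1r.
have sB i : s i - s i.+1 = layer_const * level i `^ p.
  by rewrite !sE -/(s i) sE /layer_const; ring.
have lay K : (\sum_(i < K) (s i - s i.+1)%:E * F (s i) <= V%:E)%E.
  apply: le_trans V_ge; apply: (sum_layers_le F0 Fm).
    by move=> i; exact: powR_ge0.
  move=> i; rewrite -subr_ge0 sB mulr_ge0 ?powR_ge0 ?(ltW layer_const_gt0)//.
have sB0 i : 0 < s i - s i.+1.
  by rewrite sB mulr_gt0 ?layer_const_gt0 ?powR_gt0.
have Ffin i : F (s i) \is a fin_num.
  rewrite ge0_fin_numE// ltNge leye_eq; apply/eqP => Foo.
  have := lay i.+1; rewrite big_ord_recr /= Foo gt0_muley ?lte_fin//.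
  rewrite addey ?leye_eq//.
  rewrite gt_eqF// (lt_le_trans ltNy0)// sume_ge0// => j _.
  by rewrite mule_ge0// lee_fin ltW.
pose h i := fine (F (s i)).
have hE i : F (s i) = (h i)%:E by rewrite /h fineK.
have hlay K : \sum_(i < K) layer_const * level i `^ p * h i <= V.
  rewrite -lee_fin -sumEFin; apply: le_trans (lay K).
  by apply: lee_sum => i _; rewrite hE -sB EFinM.
pose eta i := V / (2 ^+ i.+1 * level i `^ p).
have lp i : 0 < level i `^ p by rewrite powR_gt0.
have eta0 i : 0 < eta i by rewrite divr_gt0// mulr_gt0 ?exprn_gt0.
have /choice[Bs BsP] : forall i, exists Bs,
    strong_cover a L [set x | level i <= g x] Bs /\
    \sum_(B <- Bs) side L B.1 `^ delta <= 5%:R ^+ n * 2 `^ delta * (h i + eta i).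
  move=> i; apply: (@strong_cover_exists _ _ a L L0 delta _ _
    [set x | Omega x /\ ((s i)%:E < (g x `^ p)%:E)%E] delta_gt0 (@g_compact i)).
  - move=> x /= ix; have lg : level i.+1 < g x.
      by apply: lt_le_trans ix; rewrite (levelS Lam i); have := l0 i.+1; lra.
    split; first by apply: g_supp; rewrite gt_eqF// (lt_trans _ lg).
    rewrite lte_fin /s; apply: gt0_ltr_powR => //; rewrite nnegrE ?g_ge0//.
    exact: ltW.
  - by rewrite -/(F (s i)) hE lte_fin ltrDl.
exists Bs; split => [i|K]; first by have [] := BsP i.
apply: le_trans (_ : \sum_(i < K) 5%:R ^+ n * 2 `^ delta *
   (level i `^ p * h i + V / 2 * side 1 i) <= _).
  apply: ler_sum => i _; have [_ Bi] := BsP i.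
  apply: le_trans (ler_wpM2l (powR_ge0 _ _) Bi) _.
  rewrite le_eqVlt; apply/orP; left; apply/eqP.
  rewrite mulrCA; congr (_ * _); rewrite mulrDr; congr (_ + _).
  rewrite /eta /side exprS; have := lp i; move: (level i `^ p) => lv lv0.
  by field; rewrite (gt_eqF lv0) ?expf_neq0.
rewrite -mulr_sumr /cover_const -[leRHS]mulrA ler_wpM2l ?mulr_ge0 ?exprn_ge0 ?powR_ge0//.
rewrite big_split /= mulrDl mul1r; apply: lerD.
  rewrite ler_pdivlMl ?layer_const_gt0// mulr_sumr.
  by under eq_bigr do rewrite mulrA; exact: hlay.
have -> : \sum_(i < K) V / 2 * side 1 i = V / 2 * \sum_(i < K) side 1 i.
  by rewrite mulr_sumr.
apply: le_trans (ler_wpM2l (ltW (divr_gt0 V_gt0 (ltr0n R 2))) (sum_side (@ltr01 R) K)) _.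
by rewrite mulr1 divfK ?pnatr_eq0.
Qed.

End LevelCovers.

(** * Extension by zero and the mean value inequality *)

Lemma near_eq_continuous_at (T U : topologicalType) (f h : T -> U) (x : T) :
  (\forall y \near x, f y = h y) -> {for x, continuous f} -> {for x, continuous h}.
Proof.
move=> fh cf; rewrite /continuous_at /prop_for -(nbhs_singleton fh).
by apply: cvg_trans cf; exact: near_eq_cvg.
Qed.

Section Calculus.
Variables (R : realType) (n : nat).
Implicit Types (x : 'rV[R]_n) (u v : 'rV[R]_n -> R).

(** Mean value theorem along a coordinate axis. *)
Lemma axis_lipschitz v :
  (forall x i, derivable v x (delta_mx ord0 i)) ->
  forall x (i : 'I_n) (h c : R), 0 <= h ->
  (forall t, 0 <= t <= h -> enorm (gradient v (x + t *: delta_mx ord0 i)) <= c) ->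
  `|v (x + h *: delta_mx ord0 i) - v x| <= h * c.
Proof.
move=> dv x i h c h0 gc; set e := delta_mx ord0 i.
pose phi (t : R) := v (x + t *: e).
have quot t : (fun k : R => k^-1 *: ((phi \o shift t) (k *: 1) - phi t)) =
    (fun k : R => k^-1 *: ((v \o shift (x + t *: e)) (k *: e) - v (x + t *: e))).
  apply/funext => k; rewrite /phi /=; congr (_ *: (v _ - _)).
  by rewrite [k *: 1]mulr1 scalerDl addrCA.
have dphi (t : R) : is_derive t (1 : R) phi ('D_e v (x + t *: e)).
  apply: DeriveDef.
    by rewrite /derivable quot; exact: dv.
  by rewrite /derive quot.
have [t th ->] : exists2 t, t \in `[0, h] & v (x + h *: e) - v x = 'D_e v (x + t *: e) * h.
  have [] := @MVT_segment _ phi (fun t => 'D_e v (x + t *: e)) 0 h h0.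
  - apply: derivable_within_continuous => t _; exact: (@ex_derive _ _ _ _ _ _ _ (dphi t)).
  - by move=> t th; rewrite /phi scale0r addr0 subr0 => H; exists t.
rewrite normrM (ger0_norm h0) mulrC ler_wpM2l//.
move: th; rewrite in_itv /= => /gc; apply: le_trans.
by have := coord_le_enorm (gradient v (x + t *: e)) i; rewrite mxE.
Qed.

Lemma bounded_above_on_compact (K : set 'rV[R]_n) (f : 'rV[R]_n -> R) :
  compact K -> continuous f -> exists b, forall x, K x -> f x <= b.
Proof.
move=> cK cf.
have /compact_bounded[b [_ bP]] : compact [set f x | x in K].
  by apply: continuous_compact => //; exact: continuous_subspaceT.
exists (b + 1) => x Kx; apply: le_trans (ler_norm _) _.
by apply: (bP (b + 1)); [rewrite ltrDl|exists x].
Qed.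

(** Every point has a neighbourhood inside [Omega], where the extension by zero
    is [u], or one outside the support, where it vanishes. *)
Lemma C1_0_extension (Omega : set 'rV[R]_n) u : open Omega -> C1_0 Omega u ->
  exists v (K : set 'rV[R]_n),
  [/\ compact K, K `<=` Omega,
      (forall x, Omega x -> v x = u x /\ gradient v x = gradient u x) &
      (forall x, ~ K x -> v x = 0 /\ gradient v x = 0)] /\
  [/\ continuous v, (forall x i, derivable v x (delta_mx ord0 i)) &
      continuous (gradient v)].
Proof.
move=> oO [du cu cK KO]; set K := closure _ in cK KO.
pose v x : R := if x \in Omega then u x else 0.
have nearO x : Omega x -> \forall y \near x, u y = v y.
  move=> Ox; near=> y; rewrite /v mem_set//.
  by near: y; exact: open_nbhs_nbhs.
have oK : open (~` K) by apply: closed_openC; exact: closed_closure.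
have v0 x : ~ K x -> v x = 0.
  move=> nK; rewrite /v; case: ifPn => // /set_mem Ox.
  by apply/eqP; apply: contrapT => /negP u0; apply: nK; exact: subset_closure.
have nearK x : ~ K x -> \forall y \near x, (cst 0 : 'rV[R]_n -> R) y = v y.
  move=> nK; near=> y; rewrite v0//.
  by near: y; exact: open_nbhs_nbhs.
have gO x : Omega x -> gradient v x = gradient u x.
  by move=> Ox; apply/rowP => i; rewrite !mxE; rewrite (near_eq_derive _ (nearO x Ox)).
have gK x : ~ K x -> gradient v x = 0.
  move=> nK; apply/rowP => i; rewrite !mxE -(near_eq_derive _ (nearK x nK)).
  exact: derive_cst.
exists v, K; split; [split => // x Hx; split|split].
- by rewrite /v mem_set.
- exact: gO.
- exact: v0.
- exact: gK.
- move=> x; have [Ox|nO] := pselect (Omega x).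
    apply: (near_eq_continuous_at (nearO x Ox)).
    exact: differentiable_continuous (du x Ox).
  have nK : ~ K x by move=> /KO.
  by apply: (near_eq_continuous_at (nearK x nK)); exact: cst_continuous.
- move=> x i; have [Ox|nO] := pselect (Omega x).
    by apply: (near_eq_derivable (nearO x Ox)); apply: diff_derivable; exact: du.
  have nK : ~ K x by move=> /KO.
  by apply: (near_eq_derivable (nearK x nK)); exact: derivable_cst.
- move=> x; have [Ox|nO] := pselect (Omega x).
    apply: (near_eq_continuous_at _ (cu x Ox)); near=> y; rewrite gO//.
    by near: y; exact: open_nbhs_nbhs.
  have nK : ~ K x by move=> /KO.
  apply: (@near_eq_continuous_at _ _ (cst (0 : 'rV[R]_n)) _ x); last exact: cst_continuous.
  near=> y; rewrite gK//.
  by near: y; exact: open_nbhs_nbhs.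
Unshelve. all: by end_near. Qed.

Lemma enorm0 : enorm (0 : 'rV[R]_n) = 0.
Proof. by rewrite /enorm big1 ?sqrtr0// => i _; rewrite mxE expr0n. Qed.

Lemma enorm_ge0 x : 0 <= enorm x. Proof. exact: sqrtr_ge0. Qed.

End Calculus.

(** * The inequalities for compactly supported functions *)

Section Assembly.
Variables (R : realType) (n : nat) (delta : R).
Hypothesis delta_gt0 : 0 < delta.
Hypothesis delta_le : delta <= n%:R.

Lemma choquet_ge0 (d : R) (Omega : set 'rV[R]_n) f :
  (0 <= choquet_integral d Omega f)%E.
Proof. by apply: integral_ge0 => t _; exact: hausdorff_content_ge0. Qed.

Lemma eq_choquet (d : R) (Omega : set 'rV[R]_n) f f' :
  (forall x, Omega x -> f x = f' x) ->
  choquet_integral d Omega f = choquet_integral d Omega f'.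
Proof.
move=> ff'; apply: eq_integral => t _; congr hausdorff_content.
by apply/seteqP; split => x [Ox]; [rewrite ff'|rewrite -ff'].
Qed.

(** Both inequalities with any positive bound [V] for the integral of the gradient,
    as the scale used in (b) makes no sense for V = 0. *)
Lemma C1_0_choquet_bounds (Omega : set 'rV[R]_n) u (a : 'rV[R]_n) (L V p : R) :
  open Omega -> C1_0 Omega u -> 0 < L ->
  (forall x, Omega x -> u x != 0 -> forall i, a ord0 i <= x ord0 i < a ord0 i + side L 1) ->
  delta / n%:R < p -> 0 < V ->
  (choquet_integral delta Omega (fun x => (enorm (gradient u x) `^ p)%:E) <= V%:E)%E ->
  (choquet_integral delta Omega (fun x => (`|u x| `^ p)%:E) <=
     (poincare_const n delta p * L `^ p * (cover_const n delta p * V))%:E)%E /\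
  (forall kappa, 0 <= kappa -> kappa < 1 -> p < delta ->
   (choquet_integral (delta - kappa * p) Omega
     (fun x => (`|u x| `^ (p * (delta - kappa * p) / (delta - p)))%:E) <=
     (sobolev_const n delta p kappa *
      (cover_const n delta p * V) `^ ((delta - kappa * p) / (delta - p)))%:E)%E).
Proof.
move=> oO Cu L0 u_box p_gt V0 HV.
have p0 : 0 < p := exponent_gt0 delta_gt0 p_gt.
have [v [K [[cK KO vO vK] [cv dv cgv]]]] := C1_0_extension oO Cu.
pose g x := enorm (gradient v x).
have g0 x : 0 <= g x by exact: enorm_ge0.
have cg : continuous g.
  move=> x; apply: (@continuous_comp _ _ _ (gradient v) (@enorm R n)); first exact: cgv.
  exact: enorm_continuous.
have [b bP] := bounded_above_on_compact cK cg.
pose Lam := Num.max b 0 + 1.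
have gK x : ~ K x -> g x = 0 by move=> /vK[_ gx]; rewrite /g gx enorm0.
have gLam x : g x < Lam.
  rewrite /Lam; have [Kx|nK] := pselect (K x).
    by rewrite (le_lt_trans (bP x Kx))// ltr_pwDr// le_max lexx.
  by rewrite gK// ltr_pwDr// le_max lexx orbT.
have gcomp i : compact [set x | level Lam i <= g x].
  apply: (subclosed_compact _ cK).
    rewrite (_ : [set x | _] = g @^-1` [set t | level Lam i <= t])//.
    by apply: preimage_closed => //; exact: closed_ge.
  move=> x /= gx; apply: contrapT => nK.
  by move: gx; rewrite gK// leNgt (level_gt0 g0 gLam).
have gsupp x : g x != 0 -> Omega x.
  move=> gx; apply: KO; apply: contrapT => nK; by rewrite gK ?eqxx in gx.
have HVg : (choquet_integral delta Omega (fun x => (g x `^ p)%:E) <= V%:E)%E.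
  apply: le_trans HV; rewrite le_eqVlt; apply/orP; left; apply/eqP.
  by apply: eq_choquet => x Ox; rewrite /g (vO x Ox).2.
have [Bs [Bsc BsV]] := level_covers a L0 g0 gLam gcomp gsupp delta_gt0 p0 V0 HVg.
have vlip := axis_lipschitz dv.
have vbox x : v x != 0 -> forall i, a ord0 i <= x ord0 i < a ord0 i + side L 1.
  move=> vx; have Ox : Omega x.
    apply: KO; apply: contrapT => /vK[vx0 _]; by rewrite vx0 eqxx in vx.
  by apply: u_box => //; rewrite -(vO x Ox).1.
have eqv d (q : R) : choquet_integral d Omega (fun x => (`|u x| `^ q)%:E) =
    choquet_integral d Omega (fun x => (`|v x| `^ q)%:E).
  by apply: eq_choquet => x Ox; rewrite (vO x Ox).1.
rewrite eqv; split.
  exact: (poincare_bound L0 g0 gLam cg cv vlip vbox Bsc delta_gt0 delta_le p_gt BsV).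
move=> kappa k0 k1 pd; rewrite eqv.
apply: (sobolev_bound L0 g0 gLam cg cv vlip vbox Bsc delta_gt0 delta_le p_gt BsV) => //.
by rewrite mulr_gt0// cover_const_gt0.
Qed.

End Assembly.

(** * The diameter and the main theorem *)

Section Diameter.
Variables (R : realType) (n : nat).

Lemma coord_le_norm (x : 'rV[R]_n) i : `|x ord0 i| <= `|x|.
Proof.
rewrite /Num.norm /= mx_normrE.
exact: (le_bigmax _ (fun ij : 'I_1 * 'I_n => `|x ij.1 ij.2|) (ord0, i)).
Qed.

Lemma enorm_le_ediam (A : set 'rV[R]_n) x y : bounded_set A -> A x -> A y ->
  enorm (x - y) <= ediam A.
Proof.
move=> [b [_ bP]] Ax Ay; apply: ub_le_sup; last by exists x => //; exists y.
exists (n%:R * ((b + 1) + (b + 1))) => _ [s As [t At <-]].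
have le z : A z -> `|z| <= b + 1 by apply: (bP (b + 1)); rewrite ltrDl.
apply: enorm_le => i; rewrite !mxE; apply: le_trans (ler_normB _ _) _.
by apply: lerD; apply: le_trans (coord_le_norm _ _) (le _ _).
Qed.

Lemma ediam_gt0 (A : set 'rV[R]_n) : (0 < n)%N -> open A -> A !=set0 ->
  bounded_set A -> 0 < ediam A.
Proof.
move=> n0 oA [x Ax] bA; pose i := Ordinal n0.
have /nbhs_ballP[e /= e0 eA] : nbhs x A by exact: open_nbhs_nbhs.
pose y := x + (e / 2) *: delta_mx ord0 i.
have yx : (y - x) ord0 i = e / 2 by rewrite !mxE !eqxx /= mulr1 addrC addKr.
apply: lt_le_trans (_ : `|(y - x) ord0 i| <= _); first by rewrite yx normr_gt0 gt_eqF// divr_gt0.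
apply: le_trans (coord_le_enorm _ i) _; apply: enorm_le_ediam => //; apply: eA.
split=> // k j; rewrite /ball /= !mxE opprD addrA subrr sub0r normrN normrM.
rewrite (ger0_norm (ltW (divr_gt0 e0 (ltr0n R 2)))) normr_nat.
by case: (_ && _) => /=; rewrite ?mulr1 ?mulr0//; lra.
Qed.

End Diameter.

Lemma choquet_empty (R : realType) (n : nat) (d : R) (f : 'rV[R]_n -> \bar R) :
  choquet_integral d set0 f = 0%E.
Proof.
rewrite /choquet_integral (eq_integral (cst 0%E)) ?integral0// => t _.
apply/eqP; rewrite eq_le hausdorff_content_ge0 andbT.
apply: ereal_inf_lbound; exists set0, (fun=> 0), (fun=> 1); split => //.
- by move=> x [].
- by rewrite esum_set0.
Qed.

Theorem theorem4p2 (R : realType) (n : nat) (delta : R)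
    (n_ge2 : (2 <= n)%N) (delta_gt0 : 0 < delta) (delta_le : delta <= n%:R) :
  (forall p : R, delta / n%:R < p ->
    exists c : R, forall Omega : set 'rV[R]_n,
      domain Omega -> bounded_set Omega ->
      forall u : 'rV[R]_n -> R, C1_0 Omega u ->
      (choquet_integral delta Omega (fun x => (`|u x| `^ p)%:E)
       <= (c * ediam Omega `^ p)%:E *
          choquet_integral delta Omega
            (fun x => (enorm (gradient u x) `^ p)%:E))%E)
  /\
  (forall kappa p : R, 0 <= kappa -> kappa < 1 ->
    delta / n%:R < p -> p < delta ->
    exists c : R, forall Omega : set 'rV[R]_n,
      domain Omega ->
      forall u : 'rV[R]_n -> R, C1_0 Omega u ->
      (choquet_integral (delta - kappa * p) Omega
         (fun x => (`|u x| `^ (p * (delta - kappa * p) / (delta - p)))%:E)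
         `^ ((delta - p) / (p * (delta - kappa * p)))
       <= c%:E *
          choquet_integral delta Omega
            (fun x => (enorm (gradient u x) `^ p)%:E) `^ (1 / p))%E).
Proof.
have n0 : (0 < n)%N by exact: ltn_trans n_ge2.
split=> [p p_gt|kappa p k0 k1 p_gt p_lt].
- have p0 := exponent_gt0 delta_gt0 p_gt.
  pose C := poincare_const n delta p * cover_const n delta p.
  have C0 : 0 < C by rewrite mulr_gt0 ?poincare_const_gt0 ?cover_const_gt0.
  exists (C * 5 `^ p) => Omega [oO _] bO u Cu.
  set N := choquet_integral delta Omega (fun x => (enorm (gradient u x) `^ p)%:E).
  have N0 : (0 <= N)%E by exact: choquet_ge0.
  have [->|/set0P[x0 Ox0]] := eqVneq Omega set0.
    rewrite choquet_empty; apply: mule_ge0; last exact: choquet_ge0.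
    by rewrite lee_fin; apply: mulr_ge0; rewrite ?powR_ge0// mulr_ge0 ?powR_ge0 ?(ltW C0).
  pose d := ediam Omega; have d0 : 0 < d by apply: ediam_gt0 => //; exists x0.
  pose L := 5 * d; have L0 : 0 < L by rewrite mulr_gt0.
  have cE : C * 5 `^ p * d `^ p = C * L `^ p.
    by rewrite /L (powRM _ _ (ltW d0))// mulrA.
  rewrite -/d cE; have CL0 : 0 < C * L `^ p by rewrite mulr_gt0 ?powR_gt0.
  have [->|Nfin] := eqVneq N +oo%E; first by rewrite gt0_muley ?leey// lte_fin.
  have Nf : N \is a fin_num by rewrite (ge0_fin_numE N0) ltey.
  have NE := esym (fineK Nf).
  rewrite NE -EFinM; apply/lee_addgt0Pr => eps eps0.
  pose V := fine N + eps / (C * L `^ p).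
  have V0 : 0 < V by rewrite ltr_wpDl ?divr_gt0// -lee_fin -NE.
  have NV : (N <= V%:E)%E by rewrite NE lee_fin lerDl ltW ?divr_gt0.
  (* Omega lies within distance [d] of [x0] and has to fit into half the root
     cube: 2 d < L / 2. *)
  pose a : 'rV[R]_n := \row_i (x0 ord0 i - d).
  have box x : Omega x -> u x != 0 ->
      forall i, a ord0 i <= x ord0 i < a ord0 i + side L 1.
    move=> Ox _ i.
    have := le_trans (coord_le_enorm _ i) (enorm_le_ediam bO Ox0 Ox).
    rewrite !mxE -/d ler_norml /side expr1 /L => /andP[lo hi].
    by apply/andP; split; lra.
  have [+ _] := C1_0_choquet_bounds delta_gt0 delta_le oO Cu L0 box p_gt V0 NV.
  move=> /le_trans; apply; rewrite -EFinD lee_fin.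
  rewrite (_ : _ * (cover_const n delta p * V) = C * L `^ p * V); last by rewrite /C; ring.
  by rewrite /V mulrDr mulrCA mulfV ?mulr1// gt_eqF.
- have p0 := exponent_gt0 delta_gt0 p_gt.
  have dp0 : 0 < delta - p by rewrite subr_gt0.
  have d0 : 0 < delta - kappa * p.
    have := mulr_gt0 p0 (_ : 0 < 1 - kappa); rewrite subr_gt0 => /(_ k1); lra.
  set e := (delta - p) / (p * (delta - kappa * p)).
  have e0 : 0 < e by rewrite divr_gt0// mulr_gt0.
  pose C1 := sobolev_const n delta p kappa; pose C2 := cover_const n delta p.
  have C10 : 0 < C1 by exact: sobolev_const_gt0.
  have C20 : 0 < C2 by exact: cover_const_gt0.
  pose c := C1 `^ e * C2 `^ p^-1.
  have c0 : 0 < c by rewrite mulr_gt0 ?powR_gt0.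
  exists c => Omega [oO _] u Cu; rewrite div1r.
  set N := choquet_integral delta Omega (fun x => (enorm (gradient u x) `^ p)%:E).
  set S := choquet_integral _ _ _.
  have N0 : (0 <= N)%E by exact: choquet_ge0.
  have S0 : (0 <= S)%E by exact: choquet_ge0.
  have bound V : 0 < V -> (N <= V%:E)%E -> (S `^ e <= (c * V `^ p^-1)%:E)%E.
    move=> V0 NV.
    have [v [K [[cK KO vO vK] _]]] := C1_0_extension oO Cu.
    have [b bP] := bounded_above_on_compact cK (@enorm_continuous R n).
    pose B := Num.max b 0 + 1.
    have B0 : 0 < B by rewrite ltr_pwDr// le_max lexx orbT.
    pose a : 'rV[R]_n := \row_i (- B); pose L := 5 * B.
    have L0 : 0 < L by rewrite mulr_gt0.
    have box x : Omega x -> u x != 0 ->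
        forall i, a ord0 i <= x ord0 i < a ord0 i + side L 1.
      move=> Ox ux i; have Kx : K x.
        apply: contrapT => /vK[vx0 _]; move: ux.
        by rewrite -(vO x Ox).1 vx0 eqxx.
      have xB : `|x ord0 i| <= B.
        apply: le_trans (coord_le_enorm _ i) (le_trans (bP x Kx) _).
        by rewrite /B ler_wpDr// le_max lexx.
      move: xB; rewrite !mxE /side expr1 /L ler_norml => /andP[lo hi].
      by apply/andP; split; lra.
    have [_ /(_ kappa k0 k1 p_lt) SV] :=
      C1_0_choquet_bounds delta_gt0 delta_le oO Cu L0 box p_gt V0 NV.
    have SVe : (S `^ e <= (C1 * (C2 * V) `^ ((delta - kappa * p) / (delta - p)))%:E `^ e)%E.
      apply: gt0_ler_poweR => //; rewrite ?(ltW e0)// in_itv /= ?S0 ?leey//.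
      by rewrite lee_fin mulr_ge0 ?(ltW C10) ?powR_ge0.
    apply: le_trans SVe _; rewrite poweR_EFin lee_fin.
    rewrite (powRM _ (ltW C10) (powR_ge0 _ _)) -powRrM.
    have -> : (delta - kappa * p) / (delta - p) * e = p^-1.
      by rewrite /e; field; rewrite !gt_eqF//; lra.
    by rewrite (powRM _ (ltW C20) (ltW V0)) mulrA.
  have [->|Nfin] := eqVneq N +oo%E.
    by rewrite poweRyr ?gt_eqF ?invr_gt0// gt0_muley ?leey// lte_fin.
  have Nf : N \is a fin_num by rewrite (ge0_fin_numE N0) ltey.
  have NE := esym (fineK Nf).
  have [N00|Npos] := eqVneq N 0%E.
    rewrite N00 poweR0r ?mule0 ?gt_eqF ?invr_gt0//.
    apply/lee_addgt0Pr => eps eps0; rewrite add0e.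
    have ec : 0 < eps / c by rewrite divr_gt0.
    (* The energy vanishes: apply the bound with arbitrarily small [V]. *)
    have cE : c * ((eps / c) `^ p) `^ p^-1 = eps.
      rewrite -powRrM mulfV ?(gt_eqF p0)// powRr1 ?(ltW ec)//.
      by rewrite mulrCA mulfV ?mulr1 ?(gt_eqF c0).
    have NV : (N <= ((eps / c) `^ p)%:E)%E by rewrite N00 lee_fin powR_ge0.
    by have := bound _ (powR_gt0 p ec) NV; rewrite cE.
  have fN0 : 0 < fine N by rewrite -lte_fin -NE lt0e Npos N0.
  by have := bound _ fN0; rewrite -NE => /(_ (lexx _)); rewrite NE poweR_EFin -EFinM.
Qed.
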